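(* For every $\epsilon>0$ there exists $D_2=D_2(\epsilon)$ such that the following holds. If $H$ is a graph of average degree $d>D_2$, $m$ is a real number with $m\geq \epsilon|H|\sqrt{\log d}$, and $G$ is a graph satisfying $|G|\geq D_2 m$, $\kappa(G)\geq D_2|H|$, $e(G)\leq m|G|$, and every edge of $G$ lies in more than $m-1$ triangles of $G$, then $G\succ H$.
   Context: Graphs are finite and simple. $|G|$ denotes the number of vertices of a graph $G$, $e(G)$ its number of edges, and $\kappa(G)$ its (vertex) connectivity; $\log$ is the natural logarithm. A graph $H$ is a minor of $G$, written $G\succ H$, if there exist non-empty disjoint subsets $U_v\subset V(G)$, $v\in V(H)$, such that each induced subgraph $G[U_v]$ is connected, and there is an edge in $G$ between $U_v$ and $U_w$ whenever $vw$ is an edge of $H$. *)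

(* Defs.v *)
From mathcomp Require Import all_boot all_order all_algebra.

Set Implicit Arguments.
Unset Strict Implicit.
Unset Printing Implicit Defensive.

Import Order.TTheory GRing.Theory Num.Theory.

Record sgraph := SGraph {
  vertex :> finType;
  adj : rel vertex;
  adj_sym : symmetric adj;
  adj_irrefl : irreflexive adj
}.

Definition edges (G : sgraph) : {set {set G}} :=
  [set A : {set G} | [exists x : G, exists y : G,
                        adj x y && (A == [set x; y])]].

Definition num_edges (G : sgraph) : nat := #|edges G|.

Definition degree (G : sgraph) (x : G) : nat := #|[set y : G | adj x y]|.

(* For the graph without vertices this is [0 / 0 = 0]. *)
Definition avg_degree (R : numFieldType) (G : sgraph) : R :=
  ((\sum_(x : G) degree x)%N%:R / #|G|%:R)%R.

Definition triangles (G : sgraph) : {set {set G}} :=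
  [set A : {set G} | (#|A| == 3) &&
     [forall x in A, forall y in A, (x != y) ==> adj x y]].

Definition triangles_through (G : sgraph) (A : {set G}) : {set {set G}} :=
  [set T in triangles G | A \subset T].

(* The induced subgraph [G[U]] is connected.  The empty set counts as connected;
   non-emptiness is required separately wherever it matters. *)
Definition connected_in (G : sgraph) (U : {set G}) : bool :=
  [forall x in U, forall y in U,
     connect [rel u v : G | [&& u \in U, v \in U & adj u v]] x y].

Definition k_connected (G : sgraph) (k : nat) : bool :=
  (k < #|G|) &&
  [forall S : {set G}, (#|S| < k) ==> connected_in (~: S)].

(* The largest [k] such that [G] is [k]-connected; the complete graph on [n > 0]
   vertices has connectivity [n - 1], and the graph without vertices has
   connectivity [0]. *)
Definition connectivity (G : sgraph) : nat :=
  \max_(k < #|G| | k_connected G k) k.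

Definition is_minor (H G : sgraph) : Prop :=
  exists U : H -> {set G},
    [/\ forall v, U v != set0,
        forall v w, v != w -> [disjoint U v & U w],
        forall v, connected_in (U v)
      & forall v w, adj v w ->
          exists x y, [/\ x \in U v, y \in U w & adj x y]].

(* Main.v *)
(** Call a set of about [m] vertices robust if the graph induced on it has
    linear minimum degree and survives the deletion of a small linear number
    of vertices without falling apart; two of its vertices are then joined by
    a path of bounded length avoiding any few prescribed vertices.  Every dense
    graph contains a robust set.

    In a robust set a greedy (derandomised) choice yields disjoint sets of size
    [O(s)], one per vertex of [H], that realise all but a fraction [2^-(s^2)] of
    any prescribed set of pairs; with [s] of order [eps * sqrt (ln d)] they fit
    into [O(m)] vertices.  After [O(1/eps^2)] disjoint robust sets fewer than
    [|H|] pairs are left, and one extra vertex for each of them suffices.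

    A vertex of degree [O(m)] has a dense neighbourhood, because every edge
    lies in many triangles.  If boundedly many such neighbourhoods can be chosen
    almost disjoint, they give disjoint robust sets, and Menger's theorem
    provides the [O(|H|)] disjoint paths joining the pieces of each branch set:
    a path only needs two vertices of a robust set, since the rest of its
    passage can be rerouted inside.  Otherwise a set [P] of [O(m)] vertices
    receives many edges from each of the at least [|G|/2 - |P|] other vertices
    of low degree, and a single robust set in [P], for the relation "many common
    neighbours outside [P]", suffices, as the large supply of outside vertices
    makes the failure fraction [2^-(s t)] with [t] a large multiple of [s]. *)
Require Import Defs.
From mathcomp Require Import all_boot all_order all_algebra.
From mathcomp Require Import zify ring lra.
From mathcomp Require Import reals sequences exp.
From mathcomp Require boolp.

Set Implicit Arguments.
Unset Strict Implicit.
Unset Printing Implicit Defensive.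

(** * Menger's theorem *)

Section Connected.
Variables (T : finType) (e : rel T).
Hypothesis e_sym : symmetric e.
Implicit Types (x y : T) (U A B : {set T}) (p : seq T).

Definition restr (U : {set T}) : rel T :=
  [rel u v | [&& u \in U, v \in U & e u v]].

Lemma restrE U x y : restr U x y = [&& x \in U, y \in U & e x y].
Proof. by []. Qed.

(** Convertible to [connected_in] when [e] is [adj]; stated for any relation because it is also
    applied to [clique_rel]. *)
Definition conn (U : {set T}) : bool :=
  [forall x in U, forall y in U, connect (restr U) x y].

Lemma connP U :
  reflect {in U &, forall x y, connect (restr U) x y} (conn U).
Proof.
apply: (iffP forall_inP) => [h x y xU yU|h x xU]; first exact: (forall_inP (h x xU)).
by apply/forall_inP => y yU; apply: h.
Qed.

Lemma restr_sym U : connect_sym (restr U).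
Proof. by apply: sym_connect_sym => x y; rewrite !restrE e_sym andbCA. Qed.

Lemma connect_restrS (U V : {set T}) x y :
  U \subset V -> connect (restr U) x y -> connect (restr V) x y.
Proof.
move=> /subsetP UV; apply: connect_sub => u v; rewrite restrE => /and3P[uU vU euv].
by apply: connect1; rewrite restrE !UV.
Qed.

Lemma conn_root U x :
  {in U, forall y, connect (restr U) x y} -> conn U.
Proof.
move=> h; apply/connP => y z yU zU.
by apply: connect_trans (h z zU); rewrite restr_sym h.
Qed.

Lemma conn1 x : conn [set x].
Proof. by apply: (@conn_root _ x) => y /set1P->. Qed.

Lemma conn2 x y : e x y -> conn [set x; y].
Proof.
move=> exy; apply: (@conn_root _ x) => z /set2P[]-> //.
by apply: connect1; rewrite restrE !inE !eqxx orbT.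
Qed.

Lemma connU A B x : x \in A -> x \in B -> conn A -> conn B -> conn (A :|: B).
Proof.
move=> xA xB /connP cA /connP cB; apply: (@conn_root _ x) => y /setUP[yA|yB].
  exact: connect_restrS (subsetUl _ _) (cA _ _ xA yA).
exact: connect_restrS (subsetUr _ _) (cB _ _ xB yB).
Qed.

Lemma conn_path a p : path e a p -> conn [set z in a :: p].
Proof.
move=> pth; apply: (@conn_root _ a) => y; rewrite inE => yp.
elim: p a pth yp => [|b p IH] a /=; first by rewrite inE => _ /eqP->.
case/andP=> eab pth; rewrite inE => /predU1P[->//|yp].
have sub : [set z in b :: p] \subset [set z in [:: a, b & p]].
  by apply/subsetP => z; rewrite !inE => ->; rewrite orbT.
apply: connect_trans (connect_restrS sub (IH _ pth yp)).
by apply: connect1; rewrite restrE !inE !eqxx orbT.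
Qed.

End Connected.

(** * Walks, separators and linkages *)

Section Menger.
Variable T : finType.
Implicit Types (e : rel T) (X Y P Q S : {set T}).

Definition walk e X Y (s : seq T) : bool :=
  if s is a :: p then [&& a \in X, path e a p & last a p \in Y] else false.

Definition separates e X Y S : Prop := forall s, walk e X Y s -> has [in S] s.

Definition remove_edge e x y : rel T :=
  [rel u v | e u v && ~~ ((u == x) && (v == y))].

Lemma walk_shorten e X Y s :
  walk e X Y s -> exists s', [/\ walk e X Y s', uniq s' & {subset s' <= s}].
Proof.
case: s => // a p /and3P[aX pth lY].
case: (shortenP pth) lY => p' pth' u' sub' lY.
exists (a :: p'); split=> //=; first by rewrite aX pth'.
move=> z; rewrite !inE => /predU1P[->|zp]; first by rewrite eqxx.
by rewrite sub' ?orbT.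
Qed.

Section RemoveEdge.
Variables (e : rel T) (x y : T).
Let e' := remove_edge e x y.

Lemma remove_edgeE u v : e' u v = e u v && ~~ ((u == x) && (v == y)).
Proof. by []. Qed.

Lemma path_remove_edge_source a p : path e a p -> x \notin a :: p -> path e' a p.
Proof.
elim: p a => //= b p IH a /andP[eab pth]; rewrite inE negb_or => /andP[xa xp].
by rewrite /= IH // remove_edgeE eab eq_sym (negbTE xa).
Qed.

Lemma path_remove_edge_target a p : path e a p -> y \notin p -> path e' a p.
Proof.
elim: p a => //= b p IH a /andP[eab pth]; rewrite inE negb_or => /andP[yb yp].
by rewrite /= IH // remove_edgeE eab [b == y]eq_sym (negbTE yb) andbF.
Qed.

(** Stop at the first vertex in [P]: as [x] lies in [P], the arc from [x] to [y] has not been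
    traversed before. *)
Lemma prefix_walk P a p : x \in P -> path e a p -> has [in P] (a :: p) ->
  exists q, [/\ path e' a q, last a q \in P & {subset a :: q <= a :: p}].
Proof.
move=> xP; elim: p a => [|b p IH] a /=.
  by rewrite orbF => _ aP; exists [::]; split.
case/andP=> eab pth; have [aP _|aP /= hP] := boolP (a \in P).
  by exists [::]; split=> // z; rewrite !inE => /eqP->; rewrite eqxx.
have [q [pq lq sq]] := IH _ pth hP; exists (b :: q); split=> //=.
  rewrite pq remove_edgeE eab andbT /=.
  by apply: contra aP => /andP[/eqP->].
move=> z; rewrite inE => /predU1P[->|/sq]; first by rewrite inE eqxx.
by rewrite [z \in [:: a, b & p]]in_cons => ->; rewrite orbT.
Qed.

(** Start at the last vertex in [Q]: as [y] lies in [Q], the arc from [x] to [y] is not traversed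
    afterwards. *)
Lemma suffix_walk Q a p : y \in Q -> path e a p -> has [in Q] (a :: p) ->
  exists b q, [/\ b \in Q, path e' b q, last b q = last a p
                & {subset b :: q <= a :: p}].
Proof.
move=> yQ; elim: p a => [|b p IH] a /=.
  by rewrite orbF => _ aQ; exists a, [::]; split.
case/andP=> eab pth; have [hQ _|hQ] := boolP (has [in Q] (b :: p)).
  have [c [q [cQ pq lq sq]]] := IH _ pth hQ; exists c, q; split=> // z /sq.
  by rewrite [z \in [:: a, b & p]]in_cons => ->; rewrite orbT.
rewrite -[_ || has _ _]/(has [in Q] (b :: p)) (negbTE hQ) orbF => aQ.
exists a, (b :: p); split=> //; apply: path_remove_edge_target; first by rewrite /= eab.
by apply: contra hQ => yp; apply/hasP; exists y.
Qed.

(** A walk of [e] from [X] to [Y] meets [x |: S], since a walk avoiding [x] survives in [e'] and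
    meets [S]. Its part up to the first such vertex is a walk of [e'], hence meets [S']. *)
Lemma separates_source X Y S S' : separates e' X Y S ->
  separates e' X (x |: S) S' -> separates e X Y S'.
Proof.
move=> sepS sepS' [//|a p] /and3P[aX pth lY].
have hP : has [in x |: S] (a :: p).
  have [xp|xp] := boolP (x \in a :: p).
    by apply/hasP; exists x; rewrite // !inE eqxx.
  have /hasP[z zp zS] : has [in S] (a :: p).
    by apply: sepS; rewrite /= aX lY path_remove_edge_source.
  by apply/hasP; exists z; rewrite // inE zS orbT.
have [q [pq lq sq]] := prefix_walk (setU11 x S) pth hP.
have /hasP[z zq zS] : has [in S'] (a :: q) by apply: sepS'; rewrite /= aX pq.
by apply/hasP; exists z; rewrite ?sq.
Qed.

Lemma separates_target X Y S S' : separates e' X Y S ->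
  separates e' (y |: S) Y S' -> separates e X Y S'.
Proof.
move=> sepS sepS' [//|a p] /and3P[aX pth lY].
have hP : has [in y |: S] (a :: p).
  have [yp|yp] := boolP (y \in a :: p).
    by apply/hasP; exists y; rewrite // !inE eqxx.
  have /hasP[z zp zS] : has [in S] (a :: p).
    apply: sepS; rewrite /= aX lY path_remove_edge_target //.
    by apply: contra yp; rewrite inE orbC => ->.
  by apply/hasP; exists z; rewrite // inE zS orbT.
have [b [q [bQ pq lq sq]]] := suffix_walk (setU11 y S) pth hP.
have /hasP[z zq zS] : has [in S'] (b :: q) by apply: sepS'; rewrite /= bQ pq lq.
by apply/hasP; exists z; rewrite ?sq.
Qed.

Lemma separates_end X Y S : separates e' X Y S -> separates e X Y (x |: S).
Proof.
move=> sepS; apply: (separates_source sepS) => -[//|a p] /and3P[_ _ lP].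
by apply/hasP; exists (last a p); rewrite ?mem_last.
Qed.

Lemma separates_start X Y S : separates e' X Y S -> separates e X Y (y |: S).
Proof.
move=> sepS; apply: (separates_target sepS) => -[//|a p] /and3P[aQ _ _].
by apply/hasP; exists a; rewrite ?mem_head.
Qed.

End RemoveEdge.

Definition linkage e X Y k (s : 'I_k -> seq T) : Prop :=
  [/\ forall i, walk e X Y (s i), forall i, uniq (s i)
    & forall i j z, z \in s i -> z \in s j -> i = j].

(** Were [z] outside [S], following [s1] up to [z] and then [s2] would give a walk from [X] to [Y]
    avoiding [S], because [s1] can meet [S] only at its end and [s2] only at its start. *)
Lemma walk_cross e X P Q Y S s1 s2 z x0 :
  separates e X Y S -> walk e X P s1 -> walk e Q Y s2 -> uniq s1 -> uniq s2 ->
  {in s1, forall w, w \in S -> w = last x0 s1} ->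
  {in s2, forall w, w \in S -> w = head x0 s2} ->
  z \in s1 -> z \in s2 -> z \in S.
Proof.
move=> sep w1 w2 u1 u2 l1 h2 z1 z2; apply/negPn/negP => zS.
case/splitPr: z1 w1 u1 l1 => p1 p2 w1 u1 l1.
case/splitPr: z2 w2 u2 h2 => q1 q2 w2 u2 h2.
have w3 : walk e X Y (p1 ++ z :: q2).
  have {w2} [pz lz] : path e z q2 /\ last z q2 \in Y.
    case: q1 w2 {u2 h2} => [|b q1] /= /and3P[_]; first by [].
    by rewrite cat_path last_cat /= => /and3P[_ _ ->] ->.
  case: p1 w1 {u1 l1} => [|b p1] /= /and3P[->]; first by rewrite pz lz.
  by rewrite !cat_path !last_cat /= => /and3P[-> -> _] _; rewrite pz lz.
have /hasP[w wp wS] := sep _ w3; move: wp; rewrite mem_cat inE.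
case/or3P=> [wp|/eqP wz|wq]; last 2 first.
- by move: zS; rewrite -wz wS.
- have wh : w = head x0 (q1 ++ z :: q2).
    by apply: h2; rewrite // mem_cat inE wq !orbT.
  move: u2; case: q1 w2 {h2} wh => [|b q1] w2 /= wh.
    by rewrite -wh wq.
  by rewrite -wh mem_cat inE wq !orbT.
- have wl : w = last x0 (p1 ++ z :: p2).
    by apply: l1; rewrite // mem_cat wp.
  move: u1; rewrite cat_uniq => /and3P[_ /hasPn hp _].
  have := hp w; rewrite wl last_cat /= mem_last => /(_ isT) /=.
  by rewrite wl last_cat /= in wp; rewrite wp.
Qed.

Lemma bij_ord_mem k (P : {set T}) (f : 'I_k -> T) :
  #|P| = k -> (forall i, f i \in P) -> injective f ->
  forall z, z \in P -> exists i, f i = z.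
Proof.
move=> cP fP f_inj z zP.
have : z \in [set f i | i in 'I_k].
  have /eqP-> // : [set f i | i in 'I_k] == P.
  rewrite eqEcard card_imset // card_ord cP leqnn andbT.
  by apply/subsetP => _ /imsetP[i _ ->].
by case/imsetP=> i _ ->; exists i.
Qed.

Lemma linkage_glue e x y X Y S k
    (s1 : 'I_k -> seq T) (s2 : 'I_k -> seq T) :
  separates (remove_edge e x y) X Y S -> e x y -> #|S|.+1 = k ->
  #|x |: S| = k -> #|y |: S| = k ->
  linkage (remove_edge e x y) X (x |: S) s1 ->
  linkage (remove_edge e x y) (y |: S) Y s2 ->
  exists s : 'I_k -> seq T, linkage e X Y s.
Proof.
set e' := remove_edge e x y => sep exy cS cP cQ [w1 u1 d1] [w2 u2 d2].
have xS : x \notin S.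
  by apply/negP => xS; move: cP; rewrite cardsU1 xS add0n -cS => /n_Sn.
have yS : y \notin S.
  by apply/negP => yS; move: cQ; rewrite cardsU1 yS add0n -cS => /n_Sn.
pose l1 i := last x (s1 i); pose h2 i := head x (s2 i).
have l1s i : l1 i \in s1 i.
  by rewrite /l1; have := w1 i; case: (s1 i) => // a p _; rewrite /= mem_last.
have h2s i : h2 i \in s2 i.
  by rewrite /h2; have := w2 i; case: (s2 i) => // a p _; apply: mem_head.
have l1P i : l1 i \in x |: S.
  by rewrite /l1; have := w1 i; case: (s1 i) => // a p /and3P[].
have h2Q i : h2 i \in y |: S.
  by rewrite /h2; have := w2 i; case: (s2 i) => // a p /and3P[].
have l1_inj : injective l1 by move=> i j ij; apply: (d1 _ _ (l1 i)); rewrite // ij.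
have h2_inj : injective h2 by move=> i j ij; apply: (d2 _ _ (h2 i)); rewrite // ij.
have l1_uniq i z : z \in s1 i -> z \in x |: S -> z = l1 i.
  move=> zs zP; have [j jz] := bij_ord_mem cP l1P l1_inj zP.
  by rewrite -jz; congr (l1 _); apply: (d1 _ _ z); rewrite -?jz // jz.
have h2_uniq i z : z \in s2 i -> z \in y |: S -> z = h2 i.
  move=> zs zP; have [j jz] := bij_ord_mem cQ h2Q h2_inj zP.
  by rewrite -jz; congr (h2 _); apply: (d2 _ _ z); rewrite -?jz // jz.
have cross i j z : z \in s1 i -> z \in s2 j -> z \in S.
  apply: (@walk_cross e' X (x |: S) (y |: S) Y S (s1 i) (s2 j) z x) => // w ws wS.
    by apply: l1_uniq; rewrite // inE wS orbT.
  by apply: h2_uniq; rewrite // inE wS orbT.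
(* The walks of [s1] end in all of [x |: S] and those of [s2] start in all of [y |: S]. A vertex of
   [S] is matched with itself, and [x] with [y] along the removed arc. *)
pose phi z := if z == x then y else z.
have /fin_all_exists[t ht] : forall i, exists j, h2 j = phi (l1 i).
  move=> i; apply: (bij_ord_mem cQ h2Q h2_inj).
  have := l1P i; rewrite /phi !inE; case: eqP => [_ _|_ /= ->]; first by rewrite eqxx.
  by rewrite orbT.
(* [behead] drops the vertex of [S] that would otherwise occur twice in a row. *)
pose s i := if l1 i == x then s1 i ++ s2 (t i) else s1 i ++ behead (s2 (t i)).
have sub i z : z \in s i -> z \in s1 i \/ z \in s2 (t i).
  rewrite /s; case: ifP => _; rewrite mem_cat => /orP[]; auto.
  by move/mem_behead; auto.
have t_inj : injective t.
  move=> i j ij; have := ht i; rewrite ij ht /phi => E; apply: l1_inj; move: E.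
  have := l1P i; have := l1P j; rewrite !inE.
  have [->|_] := eqVneq (l1 i) x; have [->|_] := eqVneq (l1 j) x => //=.
    by move=> jS _ E; rewrite -E jS in yS.
  by move=> _ iS E; rewrite E iS in yS.
have crossx i j z : z \in s1 i -> z \in s2 (t j) -> i = j.
  move=> z1 z2; have zS := cross _ _ _ z1 z2; apply: l1_inj.
  rewrite -(l1_uniq i z) //; last by rewrite inE zS orbT.
  have : z = h2 (t j) by apply: h2_uniq; rewrite // inE zS orbT.
  rewrite ht /phi; case: eqP => // _ zy; by move: yS; rewrite -zy zS.
have wlk i : walk e X Y (s i).
  have sube : subrel e' e by move=> u v; rewrite /e' remove_edgeE => /andP[].
  move: (ht i); rewrite /phi /s /l1 /h2; have := w1 i; have := w2 (t i).
  case: (s1 i) => // a p; case: (s2 (t i)) => // b q.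
  move=> /and3P[_ pq lq] /and3P[aX pp lp] /=.
  case: eqP => [lx by_|_ bl] /=; rewrite aX cat_path last_cat (sub_path sube pp) /=.
    by rewrite lx by_ exy -by_ (sub_path sube pq).
  by rewrite -bl lq (sub_path sube pq).
have dis i j z : z \in s i -> z \in s j -> i = j.
  move=> /sub[z1|z1] /sub[z2|z2]; first exact: d1 z1 z2.
  - exact: crossx z1 z2.
  - by apply/esym; apply: crossx z2 z1.
  - by apply: t_inj; apply: d2 z1 z2.
(* Shortening supplies [uniq] and keeps the walks disjoint, as it adds no vertex. *)
have /fin_all_exists[s' hs'] i := walk_shorten (wlk i).
exists s'; split=> [i|i|i j z]; try by case: (hs' i).
by have [_ _ si] := hs' i; have [_ _ sj] := hs' j => /si zi /sj; apply: dis.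
Qed.

(* Goering's induction: if deleting the edge [(x, y)] creates a separator [S] with
   fewer than [k] vertices, then [x |: S] and [y |: S] separate [X] from [Y], and
   linkages from [X] to [x |: S] and from [y |: S] to [Y] can only meet in [S]. *)
Theorem menger e X Y k :
  (forall S, separates e X Y S -> k <= #|S|) ->
  exists s : 'I_k -> seq T, linkage e X Y s.
Proof.
have [m] := ubnP #|[set p | e p.1 p.2]|.
elim: m e X Y => // m IH e X Y le_m sepk.
have [/existsP[x /existsP[y exy]]|noedge] :=
    boolP [exists x, exists y, e x y]; last first.
  (* Without arcs every walk is a single vertex, so [X :&: Y] is a separator. *)
  have kXY : k <= #|X :&: Y|.
    apply: sepk => -[//|a [|b p]] /and3P[aX pth lY].
      by rewrite /= orbF inE aX.
    case/negP: noedge; apply/existsP; exists a; apply/existsP; exists b.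
    by case/andP: pth.
  pose f (i : 'I_k) := enum_val (widen_ord kXY i).
  exists (fun i => [:: f i]); split=> // [i|i j z].
    by have := enum_valP (widen_ord kXY i); rewrite inE /= -/(f i) => /andP[-> ->].
  rewrite !inE => /eqP-> /eqP/enum_val_inj/(congr1 val) /= ij; exact: val_inj.
pose e' := remove_edge e x y.
have le_m' : #|[set p | e' p.1 p.2]| < m.
  rewrite -ltnS; apply: leq_trans le_m; apply: proper_card.
  apply/properP; split.
    by apply/subsetP => p; rewrite !inE => /andP[].
  exists (x, y); first by rewrite inE.
  by rewrite inE /e' remove_edgeE !eqxx andbF.
have [[S [sepS ltS]]|noS] := boolp.EM (exists S, separates e' X Y S /\ #|S| < k); last first.
  have [S sepS|s [w u d]] := IH e' X Y le_m'.
    by rewrite leqNgt; apply/negP => lt; apply: noS; exists S.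
  exists s; split=> // i; have := w i; case: (s i) => // a p /and3P[aX pth lY].
  apply/and3P; split=> //; apply: sub_path pth => u' v'.
  by rewrite /e' remove_edgeE => /andP[].
have kP := sepk _ (separates_end sepS); have kQ := sepk _ (separates_start sepS).
have cS : #|S|.+1 = k.
  by apply/eqP; rewrite eqn_leq ltS; apply: leq_trans kP _; rewrite cardsU1; case: (_ \notin _).
have cP : #|x |: S| = k.
  by apply/eqP; rewrite eqn_leq kP andbT -cS cardsU1; case: (_ \notin _).
have cQ : #|y |: S| = k.
  by apply/eqP; rewrite eqn_leq kQ andbT -cS cardsU1; case: (_ \notin _).
have [S1 sepS1|s1 lk1] := IH e' X (x |: S) le_m'.
  exact: sepk (separates_source sepS sepS1).
have [S1 sepS1|s2 lk2] := IH e' (y |: S) Y le_m'.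
  exact: sepk (separates_target sepS sepS1).
exact: linkage_glue lk1 lk2.
Qed.

End Menger.

(** * Robustly connected dense subgraphs *)

Section Robust.
Variables (V : finType) (J : rel V).
Hypothesis J_sym : symmetric J.
Hypothesis J_irr : irreflexive J.
Implicit Types (u v w x y z : V) (A B C Q R U W Z : {set V}).

Definition nb x A : {set V} := [set y in A | J x y].

Definition degsum W : nat := \sum_(w in W) #|nb w W|.

(** Here [n] is the scale and [1/r] the density. Connectedness after the deletion of [R] is
    expressed by an edge across every cut, the form produced by the potential argument and consumed
    by the growth of balls. *)
Record robust (r n : nat) W : Prop := Robust {
  robust_neq0 : W != set0;
  robust_card : #|W| <= n;
  robust_deg : forall w, w \in W -> n <= 4 * r * #|nb w W|;
  robust_split : forall R W1, 64 * r ^ 2 * #|R| < n -> W1 \subset W :\: R ->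
    W1 != set0 -> (W :\: R) :\: W1 != set0 ->
    exists u v, [/\ u \in W1, v \in (W :\: R) :\: W1 & J u v]
}.

Lemma nb_sub x A : nb x A \subset A.
Proof. by apply/subsetP => y; rewrite inE => /andP[]. Qed.

Lemma leq_nb x A : #|nb x A| <= #|A|.
Proof. exact/subset_leq_card/nb_sub. Qed.

Lemma card_nbE x A : #|nb x A| = \sum_(y in A) J x y.
Proof.
rewrite -sum1_card big_mkcond [RHS]big_mkcond /=; apply: eq_bigr => y _.
by rewrite inE; case: (y \in A); case: (J x y).
Qed.

Lemma degsum_set1 W w : w \in W -> degsum W <= degsum (W :\ w) + 2 * #|nb w W|.
Proof.
move=> wW; rewrite /degsum (big_setD1 w wW) /= addnC mul2n -addnn addnA leq_add2r.
rewrite [#|nb w W|]card_nbE (big_setD1 w wW) /= J_irr add0n -big_split /=.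
apply: leq_sum => x; rewrite !inE => /andP[xw xW].
rewrite !card_nbE (big_setD1 w wW) /= addnC leq_add2l J_sym //.
Qed.

Lemma degsum_diff W R : degsum W <= degsum (W :\: R) + 2 * #|R| * #|W|.
Proof.
rewrite /degsum (bigID [in R]) /= addnC.
have -> : \sum_(i in W | i \notin R) #|nb i W| = \sum_(i in W :\: R) #|nb i W|.
  by apply: eq_bigl => i; rewrite inE andbC.
have h1 : \sum_(i in W | i \in R) #|nb i W| <= #|R| * #|W|.
  rewrite -sum_nat_const big_mkcondl /= [X in X <= _]big_mkcond [X in _ <= X]big_mkcond /=.
  by apply: leq_sum => i _; case: ifP => // _; case: ifP => // _; apply: leq_nb.
have h2 : \sum_(i in W :\: R) #|nb i W| <=
    \sum_(i in W :\: R) #|nb i (W :\: R)| + #|R| * #|W|.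
  apply: (@leq_trans (\sum_(i in W :\: R) (#|nb i (W :\: R)| + #|R|))).
    apply: leq_sum => i _; apply: leq_trans (leq_card_setU _ _).
    apply: subset_leq_card; apply/subsetP => y; rewrite !inE.
    by case: (y \in R); rewrite ?orbT ?orbF.
  rewrite big_split /= leq_add2l sum_nat_const mulnC leq_mul2l.
  by rewrite subset_leq_card ?subsetDl ?orbT.
lia.
Qed.

Lemma degsum_split W W1 : W1 \subset W ->
  (forall u v, u \in W1 -> v \in W :\: W1 -> ~~ J u v) ->
  degsum W <= degsum W1 + degsum (W :\: W1).
Proof.
move=> sub noe; rewrite /degsum (big_setID W1) /= (setIidPr sub).
apply: leq_add; apply: leq_sum => x xW; apply: subset_leq_card;
  apply/subsetP => y; rewrite !inE => /andP[yW Jxy].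
  rewrite Jxy andbT; apply/negPn/negP => yW1.
  by have := noe x y xW; rewrite inE yW1 yW Jxy => /(_ isT).
rewrite Jxy yW !andbT; apply/negP => yW1.
by have := noe y x yW1 xW; rewrite J_sym Jxy.
Qed.

End Robust.

Section RobustExists.
Import Order.TTheory GRing.Theory Num.Theory.
Variables (V : finType) (J : rel V).
Hypothesis J_sym : symmetric J.
Hypothesis J_irr : irreflexive J.
Implicit Types (u v w x y z : V) (A B C Q R U W Z : {set V}).

(* [k], [k1], [k2], [p] are the sizes of a set maximising the potential of
   [robust_exists], of the two sides of a cut of it and of the separator; [G] is
   the maximum, and [r'], [n'] are the parameters of [robust]. *)
Lemma no_sparse_cut (K : realFieldType) (G b k k1 k2 p r' n' : K) :
  (1 <= r' -> 0 < k -> 0 <= G -> 0 < b -> 2 * (r' * b) = 1 ->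
   64 * r' ^+ 2 * p < n' -> n' <= 4 * r' * (k1 + p) -> n' <= 4 * r' * (k2 + p) ->
   k1 + k2 <= k -> k <= k1 + k2 + p -> 0 <= p -> 0 <= k1 -> 0 <= k2 ->
   k * (G + b * k) <= k1 * (G + b * k1) + k2 * (G + b * k2) + 2 * p * k -> False)%R.
Proof.
move=> r1 k0 g0 b0 rb Rn n1 n2 cs cR p0 k10 k20 main.
have gk : (0 <= G * (k - k1 - k2))%R by apply: mulr_ge0 => //; lra.
have kk : ((k1 + k2) ^+ 2 <= k ^+ 2)%R.
  by rewrite ler_sqr ?nnegrE //; [apply: addr_ge0 | apply: ltW].
(* Multiplied by the size, the penalty becomes quadratic: cutting would save [2 * b * k1 * k2], and
   the degree sum lost with the separator is at most [2 * p * k]. *)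
have m1 : (b * (2 * k1 * k2) <= 2 * p * k)%R.
  have : (b * (k1 + k2) ^+ 2 <= b * k ^+ 2)%R by rewrite ler_pM2l.
  lra.
have m2 : (k1 * k2 <= 2 * r' * p * k)%R.
  have : (r' * (b * (2 * k1 * k2)) <= r' * (2 * p * k))%R by rewrite ler_pM2l //; lra.
  have -> : (r' * (b * (2 * k1 * k2)) = (2 * (r' * b)) * (k1 * k2))%R by ring.
  by rewrite rb; lra.
have rp : (64 * (r' * p) <= 64 * r' ^+ 2 * p)%R.
  have : (0 <= (r' * p) * (r' - 1))%R by apply: mulr_ge0; [apply: mulr_ge0|]; lra.
  lra.
have rp0 : (0 <= r' * p)%R by apply: mulr_ge0; lra.
have l1 : (n' <= 8 * (r' * k1))%R by lra.
have l2 : (n' <= 8 * (r' * k2))%R by lra.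
have small (x : K) : (n' <= 8 * (r' * x))%R -> (8 * (r' * p) < x)%R.
  move=> nx; have r0 : (0 < r')%R by apply: lt_le_trans r1.
  rewrite -(ltr_pM2l r0); lra.
have s1 := small _ l1; have s2 := small _ l2.
have pr : (p <= r' * p)%R by rewrite ler_peMl.
(* The larger side has at least [k / 4] vertices, so [m2] bounds the smaller one by [8 * r' * p],
   against [small]. *)
have side' (x y : K) : (0 <= x)%R -> (0 < y)%R -> (k <= 4 * y)%R ->
    (x * y <= 2 * r' * p * k)%R -> (x <= 8 * (r' * p))%R.
  move=> x0 y0 ky h; rewrite -(ler_pM2r y0); apply: le_trans h _.
  have : (0 <= 2 * (r' * p) * (4 * y - k))%R.
    by apply: mulr_ge0; [apply: mulr_ge0 => //; apply: mulr_ge0; lra|lra].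
  lra.
have [k12|k12] := leP k1 k2.
  suff : (k1 <= 8 * (r' * p))%R by lra.
  by apply: (side' k1 k2) => //; lra.
suff : (k2 <= 8 * (r' * p))%R by lra.
by apply: (side' k2 k1) => //; [lra|lra|rewrite mulrC].
Qed.

(* [W] maximises the average degree minus a linear penalty in the size. *)
Lemma robust_exists r n Q : 0 < r -> Q != set0 -> #|Q| <= n ->
  n * #|Q| <= r * degsum J Q -> exists2 W : {set V}, W \subset Q & robust J r n W.
Proof.
move=> r_gt0 Q0 Qn degQ.
have r0 : (0 < r%:R :> rat)%R by rewrite ltr0n.
(* With [b = 1/(2r)] the penalty of [Q] is at most [n/(2r)], half of the average degree [n/r] that
   [degQ] guarantees; this gives [gn]. *)
have [b [rb b0]] : exists b : rat, (2 * (r%:R * b) = 1)%R /\ (0 < b)%R.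
  exists (2 * r%:R)^-1%R; split; last by rewrite invr_gt0 mulr_gt0.
  by field; rewrite gt_eqF.
pose g (W : {set V}) : rat := ((degsum J W)%:R / #|W|%:R - b * #|W|%:R)%R.
pose P (W : {set V}) := (W \subset Q) && (W != set0).
have PQ : P Q by rewrite /P subxx Q0.
have [W [PW maxW]] : exists W, P W /\ forall U, P U -> (g U <= g W)%R.
  exists [arg max_(W > Q | P W) g W]%O; case: (arg_maxP g PQ) => W PW maxW.
  by split=> // U PU; apply: maxW.
have card0 U : P U -> (0 < #|U|%:R :> rat)%R.
  by case/andP=> _; rewrite -card_gt0 ltr0n.
have gE U : P U -> ((degsum J U)%:R = #|U|%:R * (g U + b * #|U|%:R))%R.
  by move=> PU; rewrite /g; field; rewrite gt_eqF ?card0.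
have leg U : U \subset Q -> ((degsum J U)%:R <= #|U|%:R * (g W + b * #|U|%:R))%R.
  move=> UQ; have [->|U0] := eqVneq U set0.
    by rewrite /degsum big_set0 cards0 mul0r.
  have PU : P U by rewrite /P UQ.
  by rewrite gE // ler_pM2l ?card0 // lerD2r maxW.
have gn : (n%:R <= 2 * (r%:R * g W))%R.
  have := maxW Q PQ; have := gE Q PQ; have := card0 Q PQ.
  move: degQ; rewrite -(ler_nat rat) !natrM => degQ.
  have : (#|Q|%:R <= n%:R :> rat)%R by rewrite ler_nat.
  move: (g Q) (g W) (#|Q|%:R)%R (degsum J Q)%:R%R degQ => gQ gW q D degQ qn q0 D_E gQW.
  have : (q * n%:R <= q * (r%:R * (gQ + b * q)))%R.
    by rewrite D_E in degQ; nra.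
  rewrite ler_pM2l // => h; have : (r%:R * (b * q) <= n%:R / 2)%R by nra.
  have : (r%:R * gQ <= r%:R * gW)%R by rewrite ler_pM2l.
  lra.
have /andP[WQ W0] := PW.
have k0 := card0 W PW; have DW := gE W PW.
have g0 : (0 <= g W)%R.
  have : (0 <= n%:R :> rat)%R by [].
  by nra.
(* Deleting [w] cannot raise the potential beyond its maximum, so twice the degree of [w] is at
   least [g W], which is at least [n/(2r)]. *)
have degW w : w \in W -> n <= 4 * r * #|nb J w W|.
  move=> wW; have := degsum_set1 J_sym J_irr wW.
  have := leg (W :\ w) (subset_trans (subsetDl _ _) WQ).
  have : (#|W|%:R = #|W :\ w|%:R + 1 :> rat)%R.
    by rewrite (cardsD1 w W) wW -natr1 addrC.
  rewrite -(ler_nat rat) natrD natrM DW -(ler_nat rat) !natrM.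
  have : (0 <= #|W :\ w|%:R :> rat)%R by [].
  move: gn g0 b0 r0 rb.
  move: (g W) (#|W :\ w|%:R)%R (#|W|%:R)%R (degsum J _)%:R%R (#|nb _ _ _|%:R)%R r%:R%R n%:R%R.
  move=> G k k' D d r' n' gn g0 b0 r0 rb kge -> h1 h2.
  have : (G <= 2 * d)%R by nra.
  nra.
exists W => //; split=> //.
  by apply: leq_trans Qn; apply: subset_leq_card.
move=> R W1 Rn sub1 W10 W20; set W2 := _ :\: W1 in W20 *.
have [/exists_inP[u uW1 /exists_inP[v vW2 Juv]]|noe] :=
  boolP [exists u in W1, exists v in W2, J u v]; first by exists u, v.
exfalso.
have noe' u v : u \in W1 -> v \in W2 -> ~~ J u v.
  move=> uW1 vW2; apply: contra noe => Juv; apply/exists_inP; exists u => //.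
  by apply/exists_inP; exists v.
have WRQ : W :\: R \subset Q := subset_trans (subsetDl _ _) WQ.
have leg1 := leg W1 (subset_trans sub1 WRQ).
have leg2 := leg W2 (subset_trans (subsetDl _ _) WRQ).
have split12 := degsum_split J_sym sub1 noe'.
have splitR := degsum_diff J W R.
have c12 : #|W1| + #|W2| = #|W :\: R|.
  by rewrite /W2 -(cardsID W1 (W :\: R)) (setIidPr sub1).
have cR : #|W| <= #|W :\: R| + #|R|.
  rewrite -(cardsID R W) addnC leq_add2l; exact/subset_leq_card/subsetIr.
have cR' : #|W :\: R| <= #|W| by apply/subset_leq_card/subsetDl.
have side W' W'' x : W' :|: W'' = W :\: R -> (forall u v, u \in W' -> v \in W'' -> ~~ J u v) ->
   x \in W' -> n <= 4 * r * (#|W'| + #|R|).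
  move=> U12 no xW'.
  have xW : x \in W.
    by have : x \in W :\: R; [rewrite -U12 inE xW' | rewrite inE => /andP[]].
  apply: leq_trans (degW x xW) _; rewrite leq_mul2l; apply/orP; right.
  apply: leq_trans (leq_card_setU _ _); apply: subset_leq_card.
  apply/subsetP => y; rewrite !inE => /andP[yW Jxy].
  case yR: (y \in R); first by rewrite orbT.
  have : y \in W' :|: W'' by rewrite U12 inE yR yW.
  rewrite inE orbF => /orP[//|yW'']; by have := no _ _ xW' yW''; rewrite Jxy.
have U12 : W1 :|: W2 = W :\: R.
  by rewrite /W2 -[RHS](setID _ W1) (setIidPr sub1).
have [x1 x1W] := set0Pn _ W10; have [x2 x2W] := set0Pn _ W20.
have n1 := side _ _ _ U12 noe' x1W.
have n2 : n <= 4 * r * (#|W2| + #|R|).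
  apply: (side W2 W1 x2) => //; first by rewrite setUC.
  by move=> u v uW vW; rewrite J_sym noe'.
have : ((#|W|%:R * (g W + b * #|W|%:R))%R <=
   #|W1|%:R * (g W + b * #|W1|%:R) + #|W2|%:R * (g W + b * #|W2|%:R) + 2 * #|R|%:R * #|W|%:R)%R.
  apply: le_trans (lerD (lerD leg1 leg2) (lexx _)).
  rewrite -DW -!natrM -!natrD ler_nat.
  by apply: leq_trans splitR _; rewrite leq_add2r.
have cs : (#|W1| + #|W2| <= #|W|)%N by rewrite c12.
rewrite -c12 in cR; have r1 : (1 <= r%:R :> rat)%R by rewrite ler1n.
move: Rn n1 n2 cs cR; rewrite -!(ltr_nat rat) -!(ler_nat rat) !(natrM, natrD, natrX).
move=> Rn n1 n2 cs cR main.
exact: no_sparse_cut r1 k0 g0 b0 rb Rn n1 n2 cs cR _ _ _ main.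
Qed.

End RobustExists.

(** * Linking inside a robust set *)

Section Linkable.
Variables (V : finType) (e : rel V).
Hypothesis e_sym : symmetric e.
Implicit Types (u v w x y z : V) (A B C Q R U W Z Om : {set V}).

(** [Om] may exceed [W]: adjacency inside a robust set can be virtual, realised by paths through
    vertices outside it. *)
Definition linkable W Om mu K : Prop :=
  forall Z x y, #|Z| <= mu -> x \in W :\: Z -> y \in W :\: Z ->
  exists C, [/\ C \subset Om :\: Z, conn e C, x \in C, y \in C & #|C| <= K].

Section Ball.
Variables (J : rel V) (r n : nat) (W Om : {set V}) (mu : nat).
Hypotheses (J_sym : symmetric J) (r_gt0 : 0 < r) (robW : robust J r n W).
Hypotheses (WOm : W \subset Om) (small_mu : 64 * r ^ 2 * mu < n).
Hypothesis realize : forall Z u v, #|Z| <= mu -> u \in W :\: Z -> v \in W :\: Z ->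
  J u v -> exists C, [/\ C \subset Om :\: Z, conn e C, u \in C, v \in C & #|C| <= 3].

Section Fix.
Variables (Z : {set V}) (x : V).
Hypotheses (Zmu : #|Z| <= mu) (xW : x \in W :\: Z).

Definition ball i : {set V} :=
  iter i (fun B => B :|: [set v in W :\: Z | [exists u in B, J u v]]) [set x].

Lemma ballS i : ball i.+1 = ball i :|: [set v in W :\: Z | [exists u in ball i, J u v]].
Proof. by []. Qed.

Lemma ball_subS i : ball i \subset ball i.+1.
Proof. exact: subsetUl. Qed.

Lemma ball_sub i : ball i \subset W :\: Z.
Proof.
elim: i => [|i IH]; first by rewrite sub1set.
by rewrite ballS subUset IH /=; apply/subsetP => v; rewrite inE => /andP[].
Qed.

Lemma ball_center i : x \in ball i.
Proof.
elim: i => [|i IH]; first by rewrite inE.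
exact: (subsetP (ball_subS i)).
Qed.

Lemma ball_step i u v : u \in ball i -> v \in W :\: Z -> J u v -> v \in ball i.+1.
Proof.
move=> ub vW Juv; rewrite ballS in_setU inE vW /=; apply/orP; right.
by apply/exists_inP; exists u.
Qed.

Lemma ball_conn i y : y \in ball i ->
  exists C, [/\ C \subset Om :\: Z, conn e C, x \in C, y \in C & #|C| <= 1 + 3 * i].
Proof.
elim: i y => [|i IH] y.
  rewrite inE => /eqP->; exists [set x]; rewrite cards1 inE eqxx conn1 //; split=> //.
  by rewrite sub1set (subsetP (setSD Z WOm)).
rewrite ballS in_setU => /orP[/IH[C [? ? ? ? hC]]|].
  by exists C; split=> //; apply: leq_trans hC _; rewrite leq_add2l leq_mul2l leqnSn.
rewrite inE => /andP[yW /exists_inP[u ub Juy]].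
have [C [sC cC xC uC hC]] := IH u ub.
have uW := subsetP (ball_sub i) _ ub.
have [D [sD cD uD yD hD]] := realize Zmu uW yW Juy.
exists (C :|: D); rewrite subUset sC sD !inE xC yD orbT; split=> //.
  exact: connU uC uD cC cD.
apply: leq_trans (leq_card_setU _ _) _; apply: leq_trans (leq_add hC hD) _.
by rewrite mulnS -addnA [3 * i + 3]addnC.
Qed.

(** Three steps gain [n/(8r)] vertices: the cut property yields a vertex [v] at distance exactly
    [3j + 2], whose neighbours outside [Z] lie in the ball of radius [3j + 3] but not in that of
    radius [3j]. *)
Lemma ball_grow k : ball k = W :\: Z \/ n * (k %/ 3) <= 8 * r * #|ball k|.
Proof.
suff H j : ball (3 * j) = W :\: Z \/ n * j <= 8 * r * #|ball (3 * j)|.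
  have sub j : ball (3 * (k %/ 3)) \subset ball (3 * (k %/ 3) + j).
    by elim: j => [|j IH]; rewrite ?addn0 ?subxx // addnS; apply: subset_trans IH (ball_subS _).
  have sb : ball (3 * (k %/ 3)) \subset ball k.
    by have := sub (k %% 3); rewrite (_ : 3 * _ + _ = k) // mulnC -divn_eq.
  have [E|h] := H (k %/ 3); [left|right].
    by apply/eqP; rewrite eqEsubset ball_sub -E.
  by apply: leq_trans h _; rewrite leq_mul2l subset_leq_card ?orbT.
elim: j => [|j [E|IH]]; first by right; rewrite muln0.
  left; apply/eqP; rewrite eqEsubset ball_sub andTb (_ : 3 * j.+1 = (3 * j).+3) ?mulnS // -{1}E.
  exact: subset_trans (subset_trans (ball_subS _) (ball_subS _)) (ball_subS _).
have [E|nE] := eqVneq (ball (3 * j).+1) (W :\: Z).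
  left; apply/eqP; rewrite eqEsubset ball_sub andTb (_ : 3 * j.+1 = (3 * j).+3) ?mulnS // -E.
  exact: subset_trans (ball_subS _) (ball_subS _).
right.
have [u [v [ub vW Juv]]] : exists u v,
    [/\ u \in ball (3 * j).+1, v \in (W :\: Z) :\: ball (3 * j).+1 & J u v].
  apply: (robust_split robW).
  - by apply: leq_ltn_trans small_mu; rewrite leq_mul2l Zmu orbT.
  - exact: ball_sub.
  - by apply/set0Pn; exists x; apply: ball_center.
  - apply: contra nE; rewrite setD_eq0 => h.
    by rewrite eqEsubset ball_sub.
have [vWZ vnb] : v \in W :\: Z /\ v \notin ball (3 * j).+1.
  by move: vW; rewrite inE => /andP[].
have vW' : v \in W by move: vWZ; rewrite inE => /andP[].
have vb2 : v \in ball (3 * j).+2 by apply: ball_step ub _ Juv.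
pose D := nb J v W :\: Z.
have Db : D \subset ball (3 * j).+3.
  apply/subsetP => w /setDP[/setIdP[wW Jvw] wZ].
  by apply: ball_step vb2 _ Jvw; rewrite inE wZ.
have disj : [disjoint ball (3 * j) & D].
  rewrite -setI_eq0; apply/eqP/setP => w; rewrite [RHS]inE; apply/negP.
  case/setIP=> wb /setDP[/setIdP[_ Jvw] _].
  by case/negP: vnb; apply: ball_step wb vWZ _; rewrite J_sym.
have hD : n <= 8 * r * #|D|.
  have hnb : #|nb J v W| <= #|D| + #|Z|.
    by rewrite -(cardsID Z (nb J v W)) addnC leq_add2l subset_leq_card ?subsetIr.
  have hZ : 8 * r * #|Z| < n.
    apply: leq_ltn_trans small_mu; apply: leq_mul => //.
    by move: r_gt0; clear; rewrite expnS expn1; nia.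
  have := leq_trans (robust_deg robW vW') (leq_mul (leqnn _) hnb).
  by move: hZ; clear; lia.
have : #|ball (3 * j) :|: D| <= #|ball (3 * j).+3|.
  apply: subset_leq_card; rewrite subUset Db andbT.
  exact: subset_trans (subset_trans (ball_subS _) (ball_subS _)) (ball_subS _).
move: disj; rewrite -setI_eq0 cardsU => /eqP->; rewrite cards0 subn0.
have -> : (3 * j).+3 = 3 * j.+1 by rewrite mulnS.
by move: IH hD; clear; nia.
Qed.

End Fix.

Lemma robust_linkable : linkable W Om mu (72 * r + 10).
Proof.
move=> Z x y Zmu xW yW.
(* At this radius continued growth would give [n * (8r + 1) <= 8r * n]. The radius also yields the
   bound [1 + 9 * (8r + 1) = 72r + 10]. *)
have [E|h] := ball_grow Zmu xW (3 * (8 * r + 1)); last first.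
  move: h; rewrite mulKn //.
  have : #|ball Z x (3 * (8 * r + 1))| <= n.
    apply: leq_trans (robust_card robW); apply: subset_leq_card.
    exact: subset_trans (ball_sub xW _) (subsetDl _ _).
  have : 0 < n by move: small_mu; clear; lia.
  by clear; nia.
have yb : y \in ball Z x (3 * (8 * r + 1)) by rewrite E.
have [C [sC cC xC yC hC]] := ball_conn Zmu xW yb.
exists C; split=> //; apply: leq_trans hC _; clear; lia.
Qed.

End Ball.

(** In each non-empty [X i] fix a root and join the other vertices to it one after the other,
    avoiding everything used or reserved; each connection costs at most [K] vertices, so [mu]
    suffices throughout. *)
Lemma linking (I : finType) W Om mu K (X : I -> {set V}) :
  linkable W Om mu K -> W \subset Om ->
  (forall i, X i \subset W) -> (forall i j x, x \in X i -> x \in X j -> i = j) ->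
  (K + 1) * #|\bigcup_i X i| <= mu ->
  exists Y : I -> {set V}, [/\ forall i, X i \subset Y i, forall i, Y i \subset Om,
    forall i, conn e (Y i) & forall i j x, x \in Y i -> x \in Y j -> i = j].
Proof.
move=> lnk WOm XW Xdis small; set U := \bigcup_i X i in small.
have inU i x : x \in X i -> x \in U by move=> xi; apply/bigcupP; exists i.
have rt i : exists o : option V, if o is Some r then r \in X i else X i = set0.
  by have [->|/set0Pn[r rX]] := eqVneq (X i) set0; [exists None|exists (Some r)].
have /fin_all_exists[rt_ hr] := rt.
(* Induction on the list [l] of vertices already joined to their roots. No [Y i] may swallow a
   vertex of another [X j], and an empty [X i] keeps [Y i] empty. *)
suff H (l : seq V) : uniq l -> {subset l <= U} -> exists Y : I -> {set V},
   [/\ (forall i, if rt_ i is Some r then is_true (r \in Y i) else Y i = set0),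
       forall i, Y i \subset Om,
       forall i, conn e (Y i), forall i j x, x \in Y i -> x \in Y j -> i = j &
       [/\ forall i x, x \in Y i -> x \in U -> x \in X i,
           #|U :|: \bigcup_i Y i| <= #|U| + K * size l
         & forall i x, x \in l -> x \in X i -> x \in Y i]].
  have [|Y [h1 h2 h3 h4 [h5 h6 h7]]] := H (enum U) (enum_uniq _).
    by move=> x; rewrite mem_enum.
  exists Y; split=> // i; apply/subsetP => x xX; apply: h7 => //.
  by rewrite mem_enum; apply: inU xX.
elim: l => [|x l IH] /= => [_ _|/andP[xl ul] lU].
  pose Y0 i : {set V} := if rt_ i is Some r then [set r] else set0.
  exists Y0; have E i y : y \in Y0 i -> y \in X i.
    by rewrite /Y0; have := hr i; case: (rt_ i) => [r rX /set1P->|_] //; rewrite inE.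
  split.
  - by move=> i; rewrite /Y0; case: (rt_ i) => // r; rewrite inE.
  - by move=> i; apply/subsetP => y yE; apply: (subsetP WOm); apply: (subsetP (XW i)); apply: E yE.
  - move=> i; rewrite /Y0; case: (rt_ i) => [r|]; first exact: conn1.
    by apply/connP => ? ?; rewrite inE.
  - by move=> i j y yi yj; apply: Xdis (E _ _ yi) (E _ _ yj).
  - split=> // [i y yE _|]; first exact: E yE.
    rewrite muln0 addn0; apply: subset_leq_card.
    by rewrite subUset subxx; apply/bigcupsP => i _; apply/subsetP => y yE; apply: inU (E _ _ yE).
have [|Y [h1 h2 h3 h4 [h5 h6 h7]]] := IH ul.
  by move=> y yl; apply: lU; rewrite inE yl orbT.
have xU : x \in U by apply: lU; rewrite mem_head.
have /bigcupP[i _ xi] := xU.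
have := hr i; have := h1 i; case rti: (rt_ i) => [r|] rY rX; last first.
  by move: xi; rewrite rX inE.
pose Z := (U :|: \bigcup_i Y i) :\: [set x; r].
have sl : (size l).+1 <= #|U|.
  rewrite cardE; apply: (@uniq_leq_size _ (x :: l)) => /=; first by rewrite xl.
  by move=> y /lU; rewrite mem_enum.
have Zmu : #|Z| <= mu.
  have : #|Z| <= #|U :|: \bigcup_i Y i| by apply/subset_leq_card/subsetDl.
  move: small h6 sl; clear; nia.
have xZ : x \in W :\: Z by rewrite !inE eqxx /= (subsetP (XW i)).
have rZ : r \in W :\: Z by rewrite !inE eqxx orbT /= (subsetP (XW i)).
have [C [sC cC xC rC hC]] := lnk Z x r Zmu xZ rZ.
have CZ y : y \in C -> y \in U :|: \bigcup_i Y i -> y \in [set x; r].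
  move=> yC yU; apply/negPn/negP => nxr.
  by have := subsetP sC _ yC; rewrite !inE -in_set2 (negbTE nxr) -in_setU yU.
have xrX y : y \in [set x; r] -> y \in X i by rewrite !inE => /orP[]/eqP->.
have CX j y : y \in C -> y \in Y j -> i = j.
  move=> yC yY; have yU : y \in U :|: \bigcup_i Y i.
    by rewrite inE; apply/orP; right; apply/bigcupP; exists j.
  have yX := xrX _ (CZ _ yC yU); apply: Xdis yX (h5 _ _ yY (inU _ _ yX)).
exists (fun j => if j == i then Y j :|: C else Y j); split.
- move=> j; have := h1 j; case: eqP => [->|//]; rewrite rti => _.
  by rewrite inE rY.
- move=> j; case: eqP => [->|//]; rewrite subUset h2.
  exact: subset_trans sC (subsetDl _ _).
- by move=> j; case: eqP => [->|//]; apply: connU rY rC _ cC.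
- move=> j k y; case: (eqVneq j i) => [->|ji]; case: (eqVneq k i) => [->|ki] //.
  + by rewrite inE => /orP[yi yk|/CX]; [apply: h4 yi yk|apply].
  + by rewrite inE => yj /orP[yi|/CX yC]; [apply: h4 yj yi|rewrite (yC j)].
  + exact: h4.
- split.
  + move=> j y; case: eqP => [->|_]; last exact: h5.
    rewrite inE => /orP[|yC yU]; first exact: h5.
    by apply: xrX; apply: CZ => //; rewrite inE yU.
  + rewrite mulnS addnCA [K + _]addnC -/(size l).
    apply: leq_trans (leq_add h6 hC); apply: leq_trans (leq_card_setU _ _).
    apply: subset_leq_card; rewrite subUset.
    rewrite -setUA subsetUl /=; apply/bigcupsP => j _; apply/subsetP => y yj.
    have : y \in Y j :|: C by move: yj; case: ifP => // _ yj; rewrite inE yj.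
    rewrite !inE => /orP[yY|->]; last by rewrite !orbT.
    by apply/orP; right; apply/orP; left; apply/bigcupP; exists j.
  + move=> j y; rewrite inE => /predU1P[->|yl] yX.
      by rewrite (Xdis _ _ _ yX xi) eqxx inE xC orbT.
    by case: ifP => _; rewrite ?inE (h7 _ _ yl yX).
Qed.

End Linkable.

(** * Greedy covering *)

Lemma exists_le_average (T : finType) (A : {set T}) (f : T -> nat) :
  A != set0 -> exists2 a, a \in A & #|A| * f a <= \sum_(x in A) f x.
Proof.
move=> /set0Pn[a0 a0A].
have [/exists_inP[a aA h]|] := boolP [exists a in A, #|A| * f a <= \sum_(x in A) f x].
  by exists a.
rewrite negb_exists_in => /forall_inP h; exfalso.
pose a := [arg min_(a < a0 | a \in A) f a].
have [aA mina] : a \in A /\ forall b, b \in A -> f a <= f b.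
  by rewrite /a; case: arg_minnP.
have := h a aA; rewrite -sum_nat_const; case/negP.
by apply: leq_sum => b; apply: mina.
Qed.

Lemma exists_ge_average (T : finType) (A : {set T}) (f : T -> nat) :
  A != set0 -> exists2 a, a \in A & \sum_(x in A) f x <= #|A| * f a.
Proof.
move=> /set0Pn[a0 a0A].
pose a := [arg max_(a > a0 | a \in A) f a].
have [aA maxa] : a \in A /\ forall b, b \in A -> f b <= f a.
  by rewrite /a; case: arg_maxnP.
by exists a => //; rewrite -sum_nat_const; apply: leq_sum => b; apply: maxa.
Qed.

Lemma bernoulli x m : x ^ m.+1 + m.+1 * x ^ m <= x.+1 ^ m.+1.
Proof.
elim: m => [|m IH]; first by rewrite !expn1 expn0 muln1 addn1.
rewrite [x.+1 ^ _]expnS; apply: leq_trans (leq_mul (leqnn _) IH).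
rewrite [x ^ m.+2]expnS [x ^ m.+1]expnS; move: (x ^ m) => y; nia.
Qed.

(** Bernoulli's inequality gives [(1 - 1/r)^r <= 1/2], here raised to the power [2s]. *)
Lemma pred_exp_quarter r s : 0 < r ->
  4 ^ s * r.-1 ^ (2 * r * s) <= r ^ (2 * r * s).
Proof.
case: r => // x _; rewrite succnK -[4]/(2 ^ 2) -expnM (_ : 2 * x.+1 * s = x.+1 * (2 * s)).
  rewrite !(expnM _ x.+1) -expnMn; case: s => [|s]; first by rewrite muln0.
  rewrite leq_exp2r //; apply: leq_trans (bernoulli x x).
  by rewrite mul2n -addnn leq_add2l expnS leq_mul2r leqnSn orbT.
by rewrite [2 * _]mulnC mulnA.
Qed.

(** The sets are chosen one by one, with [Z] the union of the earlier ones, whose size never exceeds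
    the total budget. *)
Lemma greedy_family (V I : finType) (P : I -> {set V} -> Prop) (f : I -> nat) :
  (forall i (Z : {set V}), #|Z| <= \sum_i f i -> exists S : {set V},
     [/\ [disjoint S & Z], #|S| <= f i & P i S]) ->
  exists S : I -> {set V}, [/\ forall i j x, x \in S i -> x \in S j -> i = j,
    forall i, #|S i| <= f i & forall i, P i (S i)].
Proof.
move=> step.
suff H (l : seq I) : uniq l -> exists S : I -> {set V},
   [/\ forall i j x, x \in S i -> x \in S j -> i = j,
       forall i, i \notin l -> S i = set0,
       forall i, i \in l -> #|S i| <= f i /\ P i (S i)
     & #|\bigcup_i S i| <= \sum_(i <- l) f i].
  have [S [h1 h2 h3 _]] := H (enum I) (enum_uniq _).
  by exists S; split=> // i; have [] := h3 i (mem_enum _ _).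
elim: l => [_|i l IH /= /andP[il ul]].
  exists (fun _ => set0); split=> // [i j x|]; first by rewrite inE.
  by rewrite big_nil big1 ?cards0.
have [S [h1 h2 h3 h4]] := IH ul.
have hZ : #|\bigcup_i S i| <= \sum_i f i.
  apply: leq_trans h4 _; rewrite big_uniq //= [X in _ <= X](bigID [in l]) /= leq_addr //.
have [D [dD sD PD]] := step i _ hZ.
have DS j x : x \in D -> x \in S j -> False.
  move=> xD xS; move: dD => /pred0P/(_ x) /=; rewrite xD /=.
  by move/negP; apply; apply/bigcupP; exists j.
exists (fun j => if j == i then D else S j); split.
- move=> j k x; case: (eqVneq j i) => [->|ji]; case: (eqVneq k i) => [->|ki] //.
  + by move=> xD /(DS _ _ xD).
  + by move=> xS xD; case: (DS _ _ xD xS).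
  + exact: h1.
- by move=> j; rewrite inE negb_or => /andP[/negbTE-> /h2].
- by move=> j; rewrite inE; case: eqVneq => [->|_ /=]; [|exact: h3].
- rewrite big_cons; apply: leq_trans (leq_add sD h4).
  apply: leq_trans (leq_card_setU _ _); apply: subset_leq_card.
  apply/bigcupsP => j _; apply/subsetP => x; case: ifP => _ xS; rewrite inE ?xS //.
  by apply/orP; right; apply/bigcupP; exists j.
Qed.

Section Cover.
Variables (V : finType) (e : rel V).
Hypothesis e_sym : symmetric e.
Implicit Types (u v w x y z : V) (A B S T U Z : {set V}).

Definition unhit S B : {set V} := [set b in B | nb e b S == set0].

Lemma nb_sum A B : \sum_(a in A) #|nb e a B| = \sum_(b in B) #|nb e b A|.
Proof.
under eq_bigr do rewrite card_nbE.
rewrite exchange_big /=; apply: eq_bigr => b _; rewrite card_nbE.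
by apply: eq_bigr => a _; rewrite e_sym.
Qed.

(** By double counting, some vertex of [A] is adjacent to at least a fraction [1/r] of the vertices
    of [B] not yet dominated; such a vertex is added [k] times. *)
Lemma greedy_cover A B r k : A != set0 ->
  (forall b, b \in B -> #|A| <= r * #|nb e b A|) ->
  exists S, [/\ S \subset A, #|S| <= k & r ^ k * #|unhit S B| <= r.-1 ^ k * #|B|].
Proof.
move=> A0 hB; elim: k => [|k [S [SA Sk hS]]].
  exists set0; rewrite sub0set cards0 !mul1n; split=> //.
  by apply: subset_leq_card; apply/subsetP => x; rewrite inE => /andP[].
set U := unhit S B in hS.
have [a aA ha] := exists_ge_average (fun a => #|nb e a U|) A0.
have hU : #|U| <= r * #|nb e a U|.
  have cA : 0 < #|A| by rewrite card_gt0.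
  rewrite -(leq_pmul2l cA) mulnCA; apply: leq_trans (leq_mul (leqnn r) ha).
  rewrite nb_sum mulnC -sum_nat_const big_distrr /=; apply: leq_sum => b.
  by rewrite inE => /andP[bB _]; apply: hB.
exists (a |: S); split.
- by rewrite subUset sub1set aA.
- by rewrite cardsU1 -(add1n k) leq_add //; case: (_ \notin _).
have sub : unhit (a |: S) B \subset U :\: nb e a U.
  apply/subsetP => x /setIdP[xB /eqP nx].
  have no y : y \in a |: S -> e x y = false.
    by move=> yS; apply/negbTE/negP => exy; have := in_set0 y; rewrite -nx inE yS exy.
  apply/setDP; split; last by rewrite inE e_sym no ?setU11 ?andbF.
  rewrite inE xB /=; apply/eqP/setP => y; rewrite !inE; apply/negP => /andP[yS].
  by rewrite no // inE yS orbT.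
have := subset_leq_card sub; rewrite cardsD (setIidPr (nb_sub _ _ _)) => le1.
have := leq_nb e a U; move: hS hU le1; rewrite !expnS.
move: (#|unhit _ _|) #|U| #|nb e a U| #|B| (r ^ k) (r.-1 ^ k) => u U' n' b R Q h1 h2 h3 h4.
have h5 : r * u <= r.-1 * U' by nia.
apply: (@leq_trans (R * (r.-1 * U'))); first by rewrite [r * R]mulnC -mulnA leq_mul2l h5 orbT.
by rewrite mulnCA -mulnA leq_mul2l h1 orbT.
Qed.

Lemma greedy_cover_quarter A B r s : 1 < r -> A != set0 ->
  (forall b, b \in B -> #|A| <= r * #|nb e b A|) ->
  exists S, [/\ S \subset A, #|S| <= 2 * r * s & 4 ^ s * #|unhit S B| <= #|B|].
Proof.
move=> r1 A0 hB; have [S [SA Sk hS]] := greedy_cover (2 * r * s) A0 hB.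
exists S; split=> //; have r'0 : 0 < r.-1 ^ (2 * r * s) by rewrite expn_gt0 -subn1 subn_gt0 r1.
rewrite -(leq_pmul2l r'0); apply: leq_trans hS.
by rewrite mulnA leq_mul2r mulnC pred_exp_quarter ?orbT // ltnW.
Qed.

Section GreedyHit.
Variables (I : finType) (B : {set V}) (U : I -> {set V}) (q : nat).
Implicit Types (X : {set I}) (i : I).

Lemma hit_average X : B != set0 -> (forall i, i \in X -> q * #|U i :&: B| <= #|B|) ->
  exists2 b, b \in B & q * #|[set i in X | b \in U i]| <= #|X|.
Proof.
move=> B0 hX.
have [b bB hb] := exists_le_average (fun b => #|[set i in X | b \in U i]|) B0.
exists b => //; have cB : 0 < #|B| by rewrite card_gt0.
rewrite -(leq_pmul2l cB) mulnCA; apply: leq_trans (leq_mul (leqnn q) hb) _.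
under eq_bigr do rewrite -sum1_card big_mkcond /=.
rewrite exchange_big /= big_distrr /= mulnC -sum_nat_const [X in _ <= X]big_mkcond /=.
apply: leq_sum => i _; case vX: (i \in X); last first.
  by rewrite big1 ?muln0 // => b' _; rewrite inE vX.
apply: leq_trans (hX i vX); rewrite leq_mul2l; apply/orP; right.
rewrite -sum1_card big_mkcond [X in _ <= X]big_mkcond /=.
by apply: leq_sum => b' _; rewrite !inE vX andbC; case: (b' \in B).
Qed.

(** Each round picks a vertex of [B] lying in at most a fraction [1/q] of the sets [U i] that still
    contain everything picked so far. *)
Lemma greedy_hit X k : B != set0 -> (forall i, i \in X -> q * #|U i :&: B| <= #|B|) ->
  exists T, [/\ T \subset B, #|T| <= k & q ^ k * #|[set i in X | T \subset U i]| <= #|X|].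
Proof.
move=> B0 hX; elim: k => [|k [T [TB Tk hT]]].
  exists set0; rewrite sub0set cards0 mul1n; split=> //; apply: subset_leq_card.
  by apply/subsetP => x; rewrite inE => /andP[].
set X' := [set _ in _ | _] in hT.
have [|b bB hb] := @hit_average X' B0; first by move=> i; rewrite inE => /andP[/hX].
exists (b |: T); split.
- by rewrite subUset sub1set bB.
- by rewrite cardsU1 -(add1n k) leq_add //; case: (_ \notin _).
rewrite expnSr -mulnA; apply: leq_trans hT; rewrite leq_mul2l; apply/orP; right.
apply: leq_trans hb; rewrite leq_mul2l; apply/orP; right; apply: subset_leq_card.
by apply/subsetP => i; rewrite !inE subUset sub1set => /and3P[-> -> ->].
Qed.

(** After [k] greedy rounds at most [#|X| %/ q ^ k] indices are left; each receives a vertex of its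
    own outside [U i]. *)
Lemma full_hit X k : 1 < q -> B != set0 ->
  (forall i, i \in X -> q * #|U i :&: B| <= #|B|) ->
  exists T, [/\ T \subset B, #|T| <= k + #|X| %/ q ^ k & forall i, i \in X -> ~~ (T \subset U i)].
Proof.
move=> q1 B0 hX; have [T [TB Tk hT]] := greedy_hit k B0 hX.
set X' := [set _ in _ | _] in hT.
have ex i : exists b, i \in X -> b \in B /\ b \notin U i.
  have [vX|] := boolP (i \in X); last by have /set0Pn[b _] := B0; exists b.
  suff : ~~ (B \subset U i) by case/subsetPn => b bB bU; exists b.
  apply/negP => /setIidPr E; have := hX i vX; rewrite E.
  by rewrite leqNgt ltn_Pmull // card_gt0.
have /fin_all_exists[b hb] := ex.
exists (T :|: [set b i | i in X']); split.
- rewrite subUset TB; apply/subsetP => _ /imsetP[i vX ->].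
  by move: vX; rewrite inE => /andP[vX _]; case: (hb i vX).
- apply: leq_trans (leq_card_setU _ _) _; apply: leq_add => //.
  apply: leq_trans (leq_imset_card _ _) _.
  by rewrite leq_divRL ?expn_gt0 ?(ltnW q1) // mulnC.
move=> i vX; have [TU|TU] := boolP (T \subset U i); last first.
  by apply: contra TU; apply: subset_trans; apply: subsetUl.
apply/subsetPn; exists (b i); last by case: (hb i vX).
by rewrite inE; apply/orP; right; apply/imsetP; exists i; rewrite // inE vX TU.
Qed.

End GreedyHit.

Lemma card_bigcup_le (I : finType) (S : I -> {set V}) : #|\bigcup_i S i| <= \sum_i #|S i|.
Proof.
elim/big_rec2: _ => [|i U k _ IH]; first by rewrite cards0.
by apply: leq_trans (leq_card_setU _ _) _; rewrite leq_add2l.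
Qed.

Lemma card_fibers (I : finType) (F : {set I * I}) :
  \sum_j #|[set i | (i, j) \in F]| = #|F|.
Proof.
rewrite -[RHS]sum1_card (partition_big (fun p : I * I => p.2) predT) //=.
apply: eq_bigr => j _; rewrite sum1_card.
have inj : injective (fun i : I => (i, j)) by move=> i i' [].
rewrite -(card_imset _ inj); apply: eq_card => -[i k]; rewrite [RHS]unfold_in /=.
apply/imsetP/andP => [[i' + [-> ->]]|[iF /eqP E]]; first by rewrite inE eqxx.
by exists i; rewrite -E // inE.
Qed.

Lemma unhitPn S B x : x \in B -> x \notin unhit S B -> exists2 y, y \in S & e x y.
Proof.
by move=> xB; rewrite inE xB => /set0Pn[y]; rewrite inE => /andP[yS exy]; exists y.
Qed.

(* [S i] dominates all but a fraction [4^-s] of [B], so [t] vertices of [B] chosen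
   one after the other miss only a fraction [2^-(s t)] of the pairs ending in [j].
   If [full], each missed pair receives a further vertex of its own. *)
Lemma bipartite_cover (I : finType) (F : {set I * I}) A B r s t (full : bool) :
  1 < r -> 0 < s -> A != set0 -> B != set0 ->
  (forall b, b \in B -> #|A| + r * (#|I| * (2 * r * s)) <= r * #|nb e b A|) ->
  4 * (#|I| * (2 * r * s) + #|I| * t.+1) <= #|B| ->
  (full -> #|F| <= 2 ^ (s * t) * #|I|) ->
  exists (S T : I -> {set V}) (F' : {set I * I}),
    [/\ forall i, S i \subset A, forall i, S i != set0, forall i, T i \subset B,
        (forall i j x, x \in S i -> x \in S j -> i = j) /\
        (forall i j x, x \in T i -> x \in T j -> i = j) &
        forall i j x, x \in S i -> x \notin T j] /\
    [/\ \sum_i #|S i| <= #|I| * (2 * r * s), \sum_i #|T i| <= #|I| * t.+1,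
        forall i x, x \in T i -> exists2 y, y \in S i & e x y,
        F' \subset F /\ forall i j, (i, j) \in F -> (i, j) \notin F' ->
          exists x y, [/\ x \in S i, y \in T j & e x y]
      & if full then F' = set0 else 2 ^ (s * t) * #|F'| <= #|F|].
Proof.
move=> r1 s0 A0 B0 hB cB hfull.
have [|S [Sdis Ssz Sprop]] := @greedy_family V I
    (fun _ S => S \subset A /\ 4 ^ s * #|unhit S B| <= #|B|) (fun _ => 2 * r * s).
  move=> _ Z; rewrite sum_nat_const => hZ.
  (* The extra summand in [hB] pays for removing the sets chosen earlier. *)
  have hA b : b \in B -> #|A| <= r * #|nb e b (A :\: Z)|.
    move=> bB; have := hB b bB.
    have : #|nb e b A| <= #|nb e b (A :\: Z)| + #|Z|.
      apply: leq_trans (leq_card_setU _ _); apply: subset_leq_card.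
      by apply/subsetP => y; rewrite !inE => /andP[-> ->]; rewrite !andbT orbC orbN.
    move/(leq_mul (leqnn r)); rewrite mulnDr => h1 h2.
    rewrite -(leq_add2r (r * (#|I| * (2 * r * s)))); apply: leq_trans h2 (leq_trans h1 _).
    by rewrite leq_add2l leq_mul2l hZ orbT.
  have [||S [SA Sk hS]] := @greedy_cover_quarter (A :\: Z) B r s r1.
  - have /set0Pn[b bB] := B0; have := hA b bB; apply: contraTneq => E.
    by rewrite -ltnNge /nb E (_ : [set _ in _ | _] = set0) ?cards0 ?muln0 ?card_gt0 //;
      apply/setP => y; rewrite !inE.
  - by move=> b bB; apply: leq_trans (hA b bB); apply/subset_leq_card/subsetDl.
  exists S; split=> //; last by split=> //; apply: subset_trans SA (subsetDl _ _).
  by rewrite disjoint_sym disjoints_subset; apply/subsetP => y yZ; rewrite inE;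
    apply/negP => /(subsetP SA); rewrite inE yZ.
have SA i : S i \subset A by case: (Sprop i).
have sumS : \sum_i #|S i| <= #|I| * (2 * r * s).
  by rewrite -sum_nat_const; apply: leq_sum => i _.
pose X j := [set i | (i, j) \in F].
have sumX : \sum_j #|X j| = #|F| by apply: card_fibers.
(* By [hfull] the extra vertices number at most [#|I|] in total, whence [t.+1] in the bound. *)
pose f j := t + if full then #|X j| %/ (2 ^ s) ^ t else 0.
have sumf : \sum_j f j <= #|I| * t.+1.
  rewrite big_split /= sum_nat_const mulnS addnC leq_add2r.
  case: (full) hfull => [/(_ isT) hF|_]; last by rewrite big1.
  have Q0 : 0 < (2 ^ s) ^ t by rewrite !expn_gt0.
  rewrite -(leq_pmul2l Q0) -expnM; apply: leq_trans hF.
  rewrite -sumX big_distrr /=; apply: leq_sum => j _.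
  by rewrite expnM mulnC leq_divM.
have unh i : 4 ^ s * #|unhit (S i) B| <= #|B| by case: (Sprop i).
have [|T [Tdis Tsz Tprop]] := @greedy_family V I
    (fun j T => [/\ T \subset B, [disjoint T & \bigcup_i S i],
      [disjoint T & unhit (S j) B] &
      if full then forall i, i \in X j -> ~~ (T \subset unhit (S i) B)
      else 2 ^ (s * t) * #|[set i in X j | T \subset unhit (S i) B]| <= #|X j|]) f.
  move=> j Z hZ.
  (* Besides the used vertices, those undominated by [S j] are forbidden, so that every vertex of
     [T j] attaches to [S j]. At most half of [B] is lost. *)
  pose R := Z :|: \bigcup_i S i :|: unhit (S j) B.
  have hR : #|B| <= 2 * #|B :\: R|.
    have h1 : #|B| <= #|B :\: R| + (#|Z| + #|\bigcup_i S i| + #|unhit (S j) B|).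
      rewrite -(cardsID R B) addnC leq_add2l.
      apply: leq_trans (subset_leq_card (subsetIr _ _)) _.
      apply: leq_trans (leq_card_setU _ _) _; rewrite leq_add2r.
      exact: leq_card_setU.
    have h2 : 4 * #|unhit (S j) B| <= #|B|.
      by apply: leq_trans (unh j); rewrite leq_mul2r -{1}[4]expn1 leq_exp2l ?s0 ?orbT.
    have h3 := leq_trans (card_bigcup_le S) sumS.
    have h4 := leq_trans hZ sumf.
    move: h1 h2 h3 h4 cB; clear.
    move: #|B| #|B :\: R| #|Z| #|\bigcup_i S i| #|unhit (S j) B| (#|I| * (2 * r * s)) (#|I| * t.+1).
    clear; lia.
  have B'0 : B :\: R != set0.
    by rewrite -card_gt0; move: hR B0; rewrite -!card_gt0; clear; lia.
  have q1 : 1 < 2 ^ s by rewrite -{1}(expn0 2) ltn_exp2l.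
  (* The fraction [4^-s] weakens to [2^-s] because [B] may have been halved. *)
  have hq i : i \in X j -> 2 ^ s * #|unhit (S i) B :&: (B :\: R)| <= #|B :\: R|.
    move=> _; rewrite -(leq_pmul2l (ltn0Sn 1)); apply: leq_trans hR.
    apply: leq_trans (unh i); rewrite mulnA; apply: leq_mul.
      by rewrite -[4]/(2 * 2) expnMn leq_mul2r q1 orbT.
    exact/subset_leq_card/subsetIl.
  have dis (T C : {set V}) : T \subset B :\: R -> C \subset R -> [disjoint T & C].
    move=> TB CR; rewrite disjoints_subset; apply: subset_trans TB _.
    apply/subsetP => y; rewrite !inE => /andP[yR _].
    by apply: contra yR => /(subsetP CR); rewrite !inE.
  have dis3 T : T \subset B :\: R ->
     [/\ T \subset B, [disjoint T & Z], [disjoint T & \bigcup_i S i]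
       & [disjoint T & unhit (S j) B]].
    move=> TB; split; first exact: subset_trans TB (subsetDl _ _).
    - by apply: dis TB _; rewrite /R -setUA subsetUl.
    - by apply: dis TB _; rewrite /R setUAC subsetUr.
    - by apply: dis TB _; rewrite /R subsetUr.
  rewrite /f; case: (full).
    have [T [TB Tk hT]] := full_hit t q1 B'0 hq.
    by have [? ? ? ?] := dis3 T TB; exists T; split.
  have [T [TB Tk hT]] := greedy_hit t B'0 hq; rewrite addn0.
  by have [? ? ? ?] := dis3 T TB; exists T; split=> //; split=> //; rewrite expnM.
pose F' := [set p in F | T p.2 \subset unhit (S p.1) B].
exists S, T, F'; split; first split=> //.
- move=> i; apply/negP => /eqP S0; have := unh i.
  have -> : unhit (S i) B = B.
    apply/setP => x; rewrite inE S0; case: (x \in B) => //=.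
    by apply/eqP/setP => y; rewrite !inE.
  by rewrite leqNgt ltn_Pmull ?card_gt0 // -[X in X < _](expn0 4) ltn_exp2l.
- by move=> i; case: (Tprop i).
- move=> i j x xS; have [_ + _ _] := Tprop j.
  rewrite disjoints_subset => /subsetP sub; apply/negP => /sub.
  by rewrite inE => /bigcupP[]; exists i.
split=> //.
- by apply: leq_trans sumf; apply: leq_sum.
- move=> i x xT; have [TB _ + _] := Tprop i.
  rewrite disjoints_subset => /subsetP sub.
  by apply: (unhitPn (subsetP TB _ xT)); have := sub _ xT; rewrite inE.
- split; first by apply/subsetP => p; rewrite inE => /andP[].
  move=> i j ijF; rewrite inE ijF /= => /subsetPn[y yT yU].
  have [TB _ _ _] := Tprop j.
  have [x xS exy] := unhitPn (subsetP TB _ yT) yU.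
  by exists x, y; rewrite e_sym.
- have := Tprop; case: (full) => {}Tprop.
    apply/setP => -[i j]; rewrite !inE /=; apply/negP => /andP[ijF sub].
    by have [_ _ _ /(_ i)] := Tprop j; rewrite inE ijF sub => /(_ isT).
  rewrite -sumX -(card_fibers F') big_distrr /=; apply: leq_sum => j _.
  have [_ _ _] := Tprop j; apply: leq_trans; rewrite leq_mul2l; apply/orP; right.
  by apply: subset_leq_card; apply/subsetP => i; rewrite !inE.
Qed.

End Cover.

(** * Many disjoint robust pieces *)

Definition has_model (V : finType) (e : rel V) (I : finType) (F : {set I * I}) : Prop :=
  exists B : I -> {set V}, [/\ forall i, B i != set0,
    forall i j x, x \in B i -> x \in B j -> i = j,
    forall i, conn e (B i)
  & forall i j, (i, j) \in F -> exists x y, [/\ x \in B i, y \in B j & e x y]].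

Section Model.
Variables (V : finType) (e : rel V).
Hypothesis e_sym : symmetric e.
Implicit Types (u v w x y z : V) (A B S T U W X Y Z : {set V}).

(** * Disjoint paths with few vertices in each piece *)

Section Shortcut.
Variables (J : finType) (W : J -> {set V}).

(* A path for this relation can be shortcut to meet each [W j] in at most two
   vertices; a step inside [W j] is later replaced by a connection in [W j]. *)
Definition clique_rel : rel V :=
  [rel u v | e u v || [exists j, (u \in W j) && (v \in W j)]].

Lemma clique_relE u v :
  clique_rel u v = e u v || [exists j, (u \in W j) && (v \in W j)].
Proof. by []. Qed.

Lemma clique_rel_sym : symmetric clique_rel.
Proof.
by move=> u v; rewrite !clique_relE e_sym; congr (_ || _); apply: eq_existsb => j; rewrite andbC.
Qed.

(** The first vertex in [W j] is joined directly to the third by a clique step, skipping at least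
    the second. *)
Lemma shortcut1 j a p : path clique_rel a p -> 2 < count [in W j] (a :: p) ->
  exists q, [/\ path clique_rel a q, last a q = last a p,
    {subset a :: q <= a :: p} & size q < size p].
Proof.
elim: p a => [|b p IH] a; first by rewrite /= addn0; case: (_ \in _).
have countE x s : count [in W j] (x :: s) = (x \in W j) + count [in W j] s by [].
move=> pth; rewrite countE.
have [aW|aW] := boolP (a \in W j); last first.
  rewrite add0n => hc; case/andP: pth => eab pth.
  have [q [pq lq sq szq]] := IH b pth hc; exists (b :: q); split=> //=.
  - by rewrite pq andbT.
  - move=> z; rewrite inE => /predU1P[->|/sq]; first by rewrite mem_head.
    by rewrite [z \in [:: a, b & p]]in_cons => ->; rewrite orbT.
rewrite add1n ltnS => hc; move: (b :: p) pth hc => {IH b}p pth hc.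
have : has [in W j] p by rewrite has_count; apply: leq_trans hc.
move=> hp; case/split_find: hp hc pth => w1 p1 p2 w1W nhas.
rewrite cat_rcons count_cat countE.
rewrite (_ : count _ p1 = 0); last by apply/eqP; rewrite -leqn0 leqNgt -has_count.
rewrite w1W add0n add1n ltnS -has_count => hp pth.
case/split_find: hp pth => w2 q1 q2 w2W _.
rewrite cat_rcons -cat_cons catA cat_path => /andP[_ /andP[_ pth]].
exists (w2 :: q2); split.
- apply/andP; split=> //; rewrite clique_relE; apply/orP; right.
  by apply/existsP; exists j; rewrite aW w2W.
- by rewrite last_cat /=.
- move=> z; rewrite in_cons => /orP[/eqP->|zq]; first exact: mem_head.
  by rewrite in_cons mem_cat zq !orbT.
- by rewrite !size_cat /= !addnS addSn !ltnS leq_addl.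
Qed.

Lemma shortcut a p : path clique_rel a p ->
  exists q, [/\ path clique_rel a q, last a q = last a p,
    {subset a :: q <= a :: p} & forall j, count [in W j] (a :: q) <= 2].
Proof.
have [m] := ubnP (size p); elim: m p => // m IH p le_m pth.
have [/existsP[j hj]|] := boolP [exists j, 2 < count [in W j] (a :: p)].
  have [q [pq lq sq szq]] := shortcut1 pth hj.
  have [q' [pq' lq' sq' cq']] := IH q (leq_trans szq le_m) pq.
  by exists q'; split=> //; [rewrite lq'|move=> z /sq'/sq].
by rewrite negb_exists => /forallP h; exists p; split=> // j; rewrite leqNgt.
Qed.

Lemma card_set_seq_cap s U : #|[set z in s] :&: U| <= count [in U] s.
Proof.
rewrite -size_filter; apply: leq_trans (card_size _).
by apply: subset_leq_card; apply/subsetP => x; rewrite !inE mem_filter andbC.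
Qed.

(** Menger's theorem followed by shortcuts. Since [Y] has exactly [k] vertices, each is the end of
    one path, and the paths can be indexed by their ends. *)
Lemma routes k X Y (y : 'I_k -> V) : injective y -> (forall i, y i \in Y) -> #|Y| = k ->
  k <= #|X| ->
  (forall S, #|S| < k -> conn e (~: S)) ->
  exists C : 'I_k -> {set V},
    [/\ forall i, y i \in C i, forall i, exists2 x, x \in C i & x \in X,
        forall i j x, x \in C i -> x \in C j -> i = j,
        forall i j, #|C i :&: W j| <= 2 & forall i, conn clique_rel (C i)].
Proof.
move=> y_inj yY cY cX cn.
have [|s [w u d]] := @menger V clique_rel X Y k.
  move=> S sep; rewrite leqNgt; apply/negP => ltS.
  have out U : k <= #|U| -> exists2 x, x \in U & x \notin S.
    move=> kU; suff /subsetPn : ~~ (U \subset S) by [].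
    by apply/negP => /subset_leq_card; rewrite leqNgt (leq_trans ltS).
  have [a aX aS] := out X cX; have [b bY bS] := out Y (eq_leq (esym cY)).
  have /connP/(_ a b) := cn S ltS; rewrite !inE aS bS => /(_ isT isT)/connectP[p pth lb].
  have wlk : walk clique_rel X Y (a :: p).
    rewrite /= aX -lb bY andbT /=; apply: sub_path pth => z t.
    by rewrite restrE => /and3P[_ _ ezt]; rewrite clique_relE ezt.
  have /hasP[z zp zS] := sep _ wlk.
  suff : z \notin S by rewrite zS.
  move: zp; rewrite inE => /predU1P[->//|zp].
  elim: p a pth zp {aX aS lb wlk} => //= c p IH a /andP[+ pth].
  rewrite restrE inE => /and3P[_ + _] /predU1P[->|zp]; first by rewrite inE.
  by move=> _; apply: IH pth zp.
pose l i := last (y i) (s i).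
have lY i : l i \in Y by rewrite /l; have := w i; case: (s i) => // a p /and3P[].
have ls i : l i \in s i.
  by rewrite /l; have := w i; case: (s i) => // a p _; rewrite /= mem_last.
have l_inj : injective l by move=> i j ij; apply: (d _ _ (l i)); rewrite // ij.
have /fin_all_exists[t ht] : forall i, exists j, l j = y i.
  by move=> i; apply: (bij_ord_mem cY lY l_inj).
have t_inj : injective t by move=> i j ij; apply: y_inj; rewrite -!ht ij.
have /fin_all_exists[C hC] : forall i, exists C : {set V},
    [/\ y i \in C, exists2 x, x \in C & x \in X, {subset C <= s (t i)},
     (forall j, #|C :&: W j| <= 2) & conn clique_rel C].
  move=> i; have := ht i; rewrite /l; have := w (t i); case: (s (t i)) => // a p.
  case/and3P=> aX pth lp ly; have [q [pq lq sq cq]] := shortcut pth.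
  exists [set z in a :: q]; split.
  - by rewrite inE -ly /= -lq mem_last.
  - by exists a; rewrite // inE mem_head.
  - by move=> z; rewrite inE => /sq.
  - by move=> j; apply: leq_trans (card_set_seq_cap _ _) (cq j).
  - exact: (conn_path clique_rel_sym pq).
exists C; split=> [i|i|i j x|i j|i]; try by case: (hC i).
by have [_ _ si _ _] := hC i; have [_ _ sj _ _] := hC j => /si xi /sj xj; apply/t_inj/(d _ _ x).
Qed.

End Shortcut.
(** The size and degree conditions of [bipartite_cover] when [A] plays both sides. *)
Definition coverable (h : nat) A (r s t : nat) : Prop :=
  [/\ A != set0, forall b, b \in A -> #|A| + r * (h * (2 * r * s)) <= r * #|nb e b A|
    & 4 * (h * (2 * r * s) + h * t.+1) <= #|A|].

Lemma cover_one (I : finType) (F : {set I * I}) A r s t (full : bool) :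
  1 < r -> 0 < s -> coverable #|I| A r s t ->
  (full -> #|F| <= 2 ^ (s * t) * #|I|) ->
  exists (X : I -> {set V}) (F' : {set I * I}),
    [/\ forall i, X i \subset A, forall i j x, x \in X i -> x \in X j -> i = j,
        \sum_i #|X i| <= #|I| * (2 * r * s + t.+1),
        F' \subset F /\ forall i j, (i, j) \in F -> (i, j) \notin F' ->
          exists x y, [/\ x \in X i, y \in X j & e x y]
      & if full then F' = set0 else 2 ^ (s * t) * #|F'| <= #|F|].
Proof.
move=> r1 s0 [A0 hA cA] hfull.
have [S [T [F' [[SA _ TA [Sd Td] STd] [sS sT _ [subF hF] hF']]]]] :=
  bipartite_cover e_sym r1 s0 A0 A0 hA cA hfull.
exists (fun i => S i :|: T i), F'; split=> //.
- by move=> i; rewrite subUset SA TA.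
- move=> i j x; rewrite !inE => /orP[xS|xT] /orP[yS|yT].
  + exact: Sd xS yS.
  + by have := STd _ j _ xS; rewrite yT.
  + by have := STd _ i _ yS; rewrite xT.
  + exact: Td xT yT.
- rewrite mulnDr; apply: leq_trans (leq_add sS sT); rewrite -big_split /=.
  by apply: leq_sum => i _; apply: leq_card_setU.
- split=> // i j ijF /(hF _ _ ijF)[x [y [xS yT exy]]].
  by exists x, y; rewrite !inE xS yT orbT.
Qed.

(** Each of [A M, ..., A 1] leaves at most a fraction [2^-(s t)] of the pairs still missing; the few
    left for [A 0] are all realised there by the [full] variant. *)
Lemma multi_cover (I : finType) (F : {set I * I}) M (A : nat -> {set V}) r s t :
  1 < r -> 0 < s -> (forall j, j <= M -> coverable #|I| (A j) r s t) ->
  #|F| <= 2 ^ (s * t * M.+1) * #|I| ->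
  exists X : nat -> I -> {set V},
    [/\ forall j i, j <= M -> X j i \subset A j,
        forall j i k x, j <= M -> x \in X j i -> x \in X j k -> i = k,
        forall j, j <= M -> \sum_i #|X j i| <= #|I| * (2 * r * s + t.+1)
      & forall i k, (i, k) \in F -> exists j x y,
          [/\ j <= M, x \in X j i, y \in X j k & e x y]].
Proof.
move=> r1 s0; elim: M F A => [|M IH] F A hA hF.
  have [||X [F' [XA Xd Xs [_ hF'] F'0]]] := @cover_one I F (A 0) r s t true r1 s0.
  - exact: hA.
  - by rewrite muln1 in hF.
  exists (fun _ => X); split=> //.
  - by move=> [|j] i.
  - by move=> j i k x _; apply: Xd.
  move=> i k ikF; have [|x [y [xX yX exy]]] := hF' i k ikF.
    by rewrite F'0 inE.
  by exists 0, x, y.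
have [||X0 [F' [XA Xd Xs [_ hF'] F'c]]] := @cover_one I F (A M.+1) r s t false r1 s0 => //.
  exact: hA.
have [||X [h1 h2 h3 h4]] := IH F' A.
- by move=> j jM; apply: hA; apply: leqW.
- have Q0 : 0 < 2 ^ (s * t) by rewrite expn_gt0.
  by rewrite -(leq_pmul2l Q0) mulnA -expnD -mulnS; apply: leq_trans F'c hF.
exists (fun j => if j == M.+1 then X0 else X j); split.
- move=> j i; case: eqVneq => [->|nj] jM //; apply: h1.
  by rewrite -ltnS ltn_neqAle nj.
- move=> j i k x; case: eqVneq => [_ _|nj jM]; first exact: Xd.
  by apply: h2; rewrite -ltnS ltn_neqAle nj.
- move=> j; case: eqVneq => [_ _|nj jM] //; apply: h3.
  by rewrite -ltnS ltn_neqAle nj.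
move=> i k ikF; have [ikF'|ikF'] := boolP ((i, k) \in F').
  have [j [x [y [jM xX yX exy]]]] := h4 _ _ ikF'; exists j, x, y.
  by rewrite (ltn_eqF (_ : j < M.+1)) ?ltnS // leqW.
have [x [y [xX yX exy]]] := hF' _ _ ikF ikF'.
by exists M.+1, x, y; rewrite eqxx.
Qed.

(** Reading the minimum degree [n/(4r)] with parameter [8r] leaves a slack of order [n], which
    absorbs both the deletion of [Z] and the vertex budget. *)
Lemma robust_coverable h r n s l W Z : 0 < r -> 0 < h -> 0 < s ->
  robust e r n W -> #|Z| <= 2 * (h * l) -> l <= s ->
  64 * r ^ 2 * ((72 * r + 11) * (h * s * (16 * r + 4))) < n ->
  coverable h (W :\: Z) (8 * r) s s.
Proof.
move=> r0 h0 s0 robW hZ ls big.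
have hZ' : #|Z| <= 2 * (h * s).
  by apply: leq_trans hZ _; rewrite leq_mul2l leq_mul2l ls !orbT.
have hs0 : 0 < h * s by rewrite muln_gt0 h0.
have big' : 1000 * (r * (r * (h * s))) < n.
  apply: leq_ltn_trans big; rewrite expnS expn1.
  move: (h * s) hs0 r0; clear => q q0 r0.
  have : 1000 <= 64 * ((72 * r + 11) * (16 * r + 4)) by nia.
  by move/(leq_mul (leqnn (r * (r * q)))); nia.
have hnb b : b \in W -> n <= 4 * r * (#|nb e b (W :\: Z)| + #|Z|).
  move=> bW; apply: leq_trans (robust_deg robW bW) _; rewrite leq_mul2l; apply/orP; right.
  apply: leq_trans (leq_card_setU _ _); apply: subset_leq_card.
  by apply/subsetP => y; rewrite !inE => /andP[-> ->]; rewrite !andbT orbC orbN.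
have [b0 b0W] := set0Pn _ (robust_neq0 robW).
have hs_h : h <= h * s by rewrite leq_pmulr.
have rq : h * s <= r * (h * s) by rewrite leq_pmull.
have rrq : r * (h * s) <= r * (r * (h * s)) by rewrite leq_pmull.
have bigW : n <= 4 * r * (#|W :\: Z| + #|Z|).
  apply: leq_trans (hnb _ b0W) _; rewrite leq_mul2l leq_add2r leq_nb orbT //.
have rZ : r * #|Z| <= 2 * (r * (h * s)).
  by rewrite mulnCA leq_mul2l hZ' orbT.
split.
- rewrite -card_gt0 lt0n; apply/negP => /eqP E.
  by move: bigW; rewrite E; move: rZ big' rrq; clear; lia.
- move=> b; rewrite inE => /andP[_ bW].
  have h1 : #|W :\: Z| <= n.
    by apply: leq_trans (robust_card robW); apply/subset_leq_card/subsetDl.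
  have -> : 8 * r * (h * (2 * (8 * r) * s)) = 128 * (r * (r * (h * s))) by clear; lia.
  have := hnb b bW; move: h1 rZ big' rrq; clear; lia.
- have -> : h * (2 * (8 * r) * s) = 16 * (r * (h * s)) by clear; lia.
  have -> : h * s.+1 = h * s + h by rewrite mulnS addnC.
  rewrite -(leq_pmul2l r0); move: bigW rZ big' rrq hs_h rq r0; clear.
  move: #|W :\: Z| #|Z| => w z.
  have -> : r * (4 * (16 * (r * (h * s)) + (h * s + h))) =
    64 * (r * (r * (h * s))) + 4 * (r * (h * s)) + 4 * (r * h) by lia.
  move=> bigW rZ big' rrq hs_h rq r0.
  have : r * h <= r * (h * s) by rewrite leq_mul2l hs_h orbT.
  lia.
Qed.

Lemma robust_large h r n s W : 0 < r -> robust e r n W ->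
  64 * r ^ 2 * ((72 * r + 11) * (h * s * (16 * r + 4))) < n -> h * s <= #|W|.
Proof.
move=> r0 robW big.
have [b0 b0W] := set0Pn _ (robust_neq0 robW).
have h1 : n <= 4 * r * #|W|.
  by apply: leq_trans (robust_deg robW b0W) _; rewrite leq_mul2l leq_nb orbT.
have r40 : 0 < 4 * r by rewrite muln_gt0.
rewrite -(leq_pmul2l r40); apply: leq_trans h1; apply: leq_trans (ltnW big).
move: r0; rewrite expnS expn1; move: (h * s); clear => q r0.
have : 4 * r <= 64 * (r * r) * ((72 * r + 11) * (16 * r + 4)) by nia.
move/(leq_mul (leqnn q)); rewrite mulnC => /leq_trans; apply.
by apply: eq_leq; lia.
Qed.

Lemma robust_linkable_self r n W mu : 0 < r -> robust e r n W ->
  64 * r ^ 2 * mu < n -> linkable e W W mu (72 * r + 10).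
Proof.
move=> r0 robW small; apply: (robust_linkable e_sym e_sym r0 robW (subxx _) small).
move=> Z u v _ uW vW euv; exists [set u; v]; rewrite !inE !eqxx orbT conn2 //.
rewrite cards2; case: (_ != _); split=> //; by apply/subsetP => z /set2P[]->.
Qed.

(** * Assembling branch sets from disjoint robust pieces *)

Section Pieces.
Variables (I : finType) (F : {set I * I}) (M r n s : nat) (W : 'I_M.+1 -> {set V}).
Hypotheses (I_gt0 : 0 < #|I|) (r_gt0 : 0 < r) (M_lt : M < s).
Hypothesis robW : forall j, robust e r n (W j).
Hypothesis disW : forall j k x, x \in W j -> x \in W k -> j = k.
Hypothesis connS : forall S, #|S| < #|I| * M.+1 -> conn e (~: S).
Hypothesis bign : 64 * r ^ 2 * ((72 * r + 11) * (#|I| * s * (16 * r + 4))) < n.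
Hypothesis smallF : #|F| <= 2 ^ (s * s * M.+1) * #|I|.

Let s_gt0 : 0 < s. Proof. exact: leq_ltn_trans M_lt. Qed.

(** [W ord0] serves as a hub: the path [C (i, j)] is to join the part of branch set [i] in [W j] to
    its part in the hub. *)
Lemma piece_routes : exists C : I * 'I_M.+1 -> {set V},
    [/\ forall i j, exists2 x, x \in C (i, j) & x \in W j,
        forall p, exists2 x, x \in C p & x \in W ord0,
        forall p q x, x \in C p -> x \in C q -> p = q,
        forall p j, #|C p :&: W j| <= 2 & forall p, conn (clique_rel W) (C p)].
Proof.
have hW j : #|I| * M.+1 <= #|W j|.
  by apply: leq_trans (robust_large r_gt0 (robW j) bign); rewrite leq_mul2l M_lt orbT.
have /fin_all_exists[g hg] : forall j : 'I_M.+1, exists g : I -> V,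
    injective g /\ forall i, g i \in W j.
  move=> j; have le : #|I| <= #|W j| by apply: leq_trans (hW j); rewrite leq_pmulr.
  exists (fun i => enum_val (widen_ord le (enum_rank i))); split=> [i i'|i].
    by move/enum_val_inj/(congr1 val) => /= /val_inj/enum_rank_inj.
  exact: enum_valP.
pose P : finType := (I * 'I_M.+1)%type.
have cP : #|P| = #|I| * M.+1 by rewrite card_prod card_ord.
pose y0 (p : P) := g p.2 p.1.
have y0W p : y0 p \in W p.2 by have [_ h] := hg p.2; apply: h.
have y0_inj : injective y0.
  move=> [i j] [i' j'] E; have jj : j = j'.
    by apply: (disW (y0W (i, j))); rewrite E; apply: (y0W (i', j')).
  by move: E; rewrite /y0 /= jj => /(proj1 (hg j'))->.
have y_inj : injective (fun i : 'I_#|P| => y0 (enum_val i)).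
  by move=> i j /y0_inj/enum_val_inj.
have [||||C [h1 h2 h3 h4 h5]] :=
    @routes _ W #|P| (W ord0) [set y0 p | p : P] _ y_inj.
- by move=> i; apply/imsetP; exists (enum_val i).
- by rewrite card_imset.
- by rewrite cP.
- by rewrite cP.
exists (fun p => C (enum_rank p)); split=> // [i j|p q x xp xq].
  exists (y0 (i, j)); last exact: (y0W (i, j)).
  by have := h1 (enum_rank (i, j)); rewrite enum_rankK.
exact/enum_rank_inj/(h3 _ _ x).
Qed.

Lemma pieces_model : has_model e F.
Proof.
have [C [Cend Chub Cdis C2 Cconn]] := piece_routes.
(* Path vertices, at most two per path in each piece, are kept out of the covering sets. *)
pose Z (j : 'I_M.+1) := \bigcup_p (C p :&: W j).
have cZ j : #|Z j| <= 2 * (#|I| * M.+1).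
  apply: leq_trans (card_bigcup_le _) _.
  apply: (@leq_trans (\sum_(p : I * 'I_M.+1) 2)); first by apply: leq_sum => p _.
  by rewrite sum_nat_const card_prod card_ord mulnC.
have [||||X0 [X0A X0d X0s X0c]] :=
    @multi_cover I F M (fun j => W (inord j) :\: Z (inord j)) (8 * r) s s.
- by lia.
- exact: s_gt0.
- by move=> j _; apply: robust_coverable (cZ _) _ bign.
- exact: smallF.
pose X (j : 'I_M.+1) := X0 (val j).
have XA j i : X j i \subset W j :\: Z j.
  by have := X0A j i; rewrite inord_val; apply; rewrite -ltnS.
have Xd j i k x : x \in X j i -> x \in X j k -> i = k.
  by apply: X0d; rewrite -ltnS ltn_ord.
have Xs j : \sum_i #|X j i| <= #|I| * (2 * (8 * r) * s + s.+1).
  by apply: X0s; rewrite -ltnS ltn_ord.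
(* All that branch set [i] must contain in [W j]; [linking] makes these sets connected and keeps
   them disjoint. *)
pose D j i := X j i :|: \bigcup_k (C (i, k) :&: W j).
have DP j i x : x \in D j i -> x \in W j /\
    (x \in X j i /\ x \notin Z j \/ exists k, x \in C (i, k)).
  rewrite inE => /orP[xX|/bigcupP[k _ /setIP[xC xW]]]; last by split=> //; right; exists k.
  by have := subsetP (XA j i) _ xX; rewrite inE => /andP[xZ ->]; split=> //; left.
have CZ p j x : x \in C p -> x \in W j -> x \in Z j.
  by move=> xC xW; apply/bigcupP; exists p; rewrite // inE xC.
have Ddis j i k x : x \in D j i -> x \in D j k -> i = k.
  move=> /DP[xW [[xX xZ]|[l xC]]] /DP[_ [[xX' xZ']|[l' xC']]].
  + exact: Xd xX xX'.
  + by rewrite (CZ _ _ _ xC' xW) in xZ.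
  + by rewrite (CZ _ _ _ xC xW) in xZ'.
  + by have [] := Cdis _ _ _ xC xC'.
have DW j i : D j i \subset W j by apply/subsetP => x /DP[].
have Dsz j : (72 * r + 10 + 1) * #|\bigcup_i D j i| <=
    (72 * r + 11) * (#|I| * s * (16 * r + 4)).
  rewrite -addnA leq_mul2l; apply/orP; right.
  have : #|\bigcup_i D j i| <= #|\bigcup_i X j i| + #|Z j|.
    apply: leq_trans (leq_card_setU _ _); apply: subset_leq_card.
    apply/bigcupsP => i _; apply/subsetP => x; rewrite !inE => /orP[xX|/bigcupP[k _ xC]].
      by apply/orP; left; apply/bigcupP; exists i.
    by apply/orP; right; apply/bigcupP; exists (i, k).
  have := card_bigcup_le (X j); have := Xs j; have := cZ j.
  have : #|I| * M.+1 <= #|I| * s by rewrite leq_mul2l M_lt orbT.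
  have : #|I| <= #|I| * s by rewrite leq_pmulr.
  have -> : #|I| * (2 * (8 * r) * s + s.+1) = 16 * (#|I| * s * r) + #|I| * s + #|I|.
    by rewrite mulnDr mulnS; clear; lia.
  have -> : #|I| * s * (16 * r + 4) = 16 * (#|I| * s * r) + 4 * (#|I| * s).
    by clear; lia.
  by clear; lia.
have lnk j : exists Y : I -> {set V}, [/\ forall i, D j i \subset Y i,
    forall i, Y i \subset W j, forall i, conn e (Y i)
    & forall i k x, x \in Y i -> x \in Y k -> i = k].
  apply: (linking e_sym (robust_linkable_self r_gt0 (robW j) bign)) => //.
  exact: Ddis.
have /fin_all_exists[Y hY] := lnk.
have DY j i x : x \in D j i -> x \in Y j i by have [/(_ i)/subsetP sub _ _ _] := hY j; apply: sub.
have YW j i x : x \in Y j i -> x \in W j by have [_ /(_ i)/subsetP sub _ _] := hY j; apply: sub.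
have CD i k j x : x \in C (i, k) -> x \in W j -> x \in D j i.
  move=> xC xW; rewrite inE; apply/orP; right; apply/bigcupP; exists k => //.
  by rewrite inE xC.
pose B i := (\bigcup_j Y j i) :|: \bigcup_k C (i, k).
have YB j i x : x \in Y j i -> x \in B i.
  by move=> xY; rewrite inE; apply/orP; left; apply/bigcupP; exists j.
have CB i k x : x \in C (i, k) -> x \in B i.
  by move=> xC; rewrite inE; apply/orP; right; apply/bigcupP; exists k.
have BY i j x : x \in B i -> x \in W j -> x \in Y j i.
  rewrite inE => /orP[/bigcupP[k _ xY]|/bigcupP[k _ xC]] xW.
    by rewrite (disW xW (YW _ _ _ xY)).
  by apply: DY; apply: CD xC xW.
have Yc j i x y : x \in Y j i -> y \in Y j i -> connect (restr e (B i)) x y.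
  move=> xY yY; have [_ _ /(_ i)/connP/(_ x y xY yY) + _] := hY j.
  by apply: connect_restrS; apply/subsetP => z; apply: YB.
(* A clique step inside [W j] joins two vertices of [D j i] and is realised within the connected set
   [Y j i]. *)
have Cc i k x y : x \in C (i, k) -> y \in C (i, k) -> connect (restr e (B i)) x y.
  move=> xC yC; have /connP/(_ x y xC yC) := Cconn (i, k).
  apply: connect_sub => u v; rewrite restrE clique_relE => /and3P[uC vC /orP[euv|]].
    by apply: connect1; rewrite restrE !(CB i k).
  by case/existsP=> j /andP[uW vW]; apply: (Yc j); apply/DY/CD; eauto.
exists B; split.
- move=> i; have [x xC _] := Chub (i, ord0).
  by apply/set0Pn; exists x; apply: CB xC.
- move=> i k x xi xk.
  have [/existsP[j xW]|] := boolP [exists j, x \in W j].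
    have [_ _ _ Yd] := hY j; exact: Yd (BY _ _ _ xi xW) (BY _ _ _ xk xW).
  rewrite negb_exists => /forallP nW.
  have inC l : x \in B l -> exists j, x \in C (l, j).
    rewrite inE => /orP[/bigcupP[j _ /YW]|/bigcupP[j _ xC]]; last by exists j.
    by rewrite (negbTE (nW j)).
  have [j xC] := inC i xi; have [j' xC'] := inC k xk.
  by have [] := Cdis _ _ _ xC xC'.
- move=> i; have [z zC zW] := Chub (i, ord0).
  have zY : z \in Y ord0 i by apply/DY/(CD _ ord0).
  have hub k y : y \in C (i, k) -> connect (restr e (B i)) z y.
    move=> yC; have [z' zC' zW'] := Chub (i, k).
    apply: connect_trans (Cc _ _ _ _ zC' yC); apply: (Yc ord0) => //.
    exact/DY/(CD _ k).
  apply: (@conn_root _ _ e_sym _ z) => y; rewrite inE.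
  case/orP=> /bigcupP[j _ yj]; last exact: hub yj.
  have [x xC xW] := Cend i j; apply: connect_trans (hub _ _ xC) _.
  by apply: (Yc j) => //; apply/DY/(CD _ j).
move=> i k /X0c[j [x [y [jM xX yX exy]]]].
pose j' : 'I_M.+1 := Ordinal (jM : j < M.+1).
by exists x, y; split=> //; apply: (YB j'); apply: DY; rewrite inE /X /= ?xX ?yX.
Qed.

End Pieces.
End Model.

(** * Unbalanced dense bipartite graphs *)

Section Unbalanced.
Variables (V : finType) (e : rel V).
Hypothesis e_sym : symmetric e.
Variables (I : finType) (F : {set I * I}) (P L : {set V}) (n r r1 s t : nat).
Implicit Types (u v w x y z : V) (A B S T U W X Y Z : {set V}).

Hypothesis r_def : r = 4 * r1 ^ 2.
Hypotheses (I_gt0 : 0 < #|I|) (r1_gt0 : 0 < r1) (s_gt0 : 0 < s).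
Hypothesis disPL : [disjoint P & L].
Hypothesis cardP : #|P| <= n.
Hypothesis degL : forall x, x \in L -> n <= r1 * #|nb e x P|.
Hypothesis bign : 64 * r ^ 2 * ((72 * r + 11) * (32 * r ^ 2 * (#|I| * s))) < n.
Hypothesis bigL : 32 * r ^ 2 * (n + #|I| * t.+1) <= #|L|.
Hypothesis smallF : #|F| <= 2 ^ (s * t) * #|I|.

Definition common u v : {set V} := [set x in L | e x u && e x v].

(** The virtual adjacency: such a pair can be joined through a vertex of [L] even after many of
    these have been used. *)
Definition codense : rel V := [rel u v | (u != v) && (#|L| <= r * #|common u v|)].

Lemma codenseE u v : codense u v = (u != v) && (#|L| <= r * #|common u v|).
Proof. by []. Qed.

Lemma codense_sym : symmetric codense.
Proof.
move=> u v; rewrite !codenseE eq_sym; congr (_ && (_ <= _ * #|pred_of_set _|)).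
by apply/setP => x; rewrite !inE [e x u && _]andbC.
Qed.

Lemma codense_irr : irreflexive codense.
Proof. by move=> u; rewrite codenseE eqxx. Qed.

Lemma sum_common W :
  \sum_(u in W) \sum_(v in W) #|common u v| = \sum_(x in L) #|nb e x W| ^ 2.
Proof.
have E x : #|nb e x W| ^ 2 = \sum_(u in W) \sum_(v in W) (e x u && e x v : nat).
  rewrite -mulnn {1}card_nbE big_distrl /=; apply: eq_bigr => u _.
  rewrite card_nbE big_distrr /=; apply: eq_bigr => v _.
  by case: (e x u); case: (e x v).
under [RHS]eq_bigr do rewrite E.
rewrite [RHS]exchange_big /=; apply: eq_bigr => u _.
rewrite [RHS]exchange_big /=; apply: eq_bigr => v _.
rewrite -sum1_card big_mkcond [RHS]big_mkcond /=; apply: eq_bigr => x _.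
by rewrite inE; case: (x \in L).
Qed.

Let r_gt0 : 0 < r. Proof. by rewrite r_def muln_gt0 expn_gt0 r1_gt0. Qed.
Let n_gt0 : 0 < n. Proof. by apply: leq_ltn_trans bign. Qed.
Let L_gt0 : 0 < #|L|.
Proof. by apply: leq_trans bigL; rewrite !muln_gt0 r_gt0 addn_gt0 n_gt0. Qed.
Let r_le_n : r <= n.
Proof.
apply: leq_trans (ltnW bign); have q0 : 0 < #|I| * s by rewrite muln_gt0 I_gt0.
move: r_gt0 q0; rewrite expnS expn1; move: (#|I| * s) => q; clear; nia.
Qed.

Lemma P_neq0 : P != set0.
Proof.
have /set0Pn[x xL] : L != set0 by rewrite -card_gt0.
by apply: contraTneq (degL xL) => ->; rewrite -ltnNge (leq_ltn_trans _ n_gt0) //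
   (_ : nb e x set0 = set0) ?cards0 ?muln0 //; apply/setP => y; rewrite !inE.
Qed.

(** Paths of length two with middle vertex in [L] are counted: [degL] and [r = 4 * r1 ^ 2] give at
    least [4 * #|L| * n ^ 2 / r], of which the diagonal and the pairs that are not codense account
    for at most half. *)
Lemma codense_degsum : n * #|P| <= r * degsum codense P.
Proof.
have h1 : 4 * (#|L| * n ^ 2) <= r * \sum_(x in L) #|nb e x P| ^ 2.
  rewrite r_def -mulnA leq_mul2l /= -sum_nat_const big_distrr /=.
  by apply: leq_sum => x xL; rewrite -expnMn leq_exp2r // degL.
have h2 : r * \sum_(u in P) \sum_(v in P) #|common u v| <=
    \sum_(u in P) (r * #|L| * #|nb codense u P| + #|P| * #|L| + r * #|L|).
  rewrite big_distrr /=; apply: leq_sum => u uP; rewrite card_nbE !big_distrr /=.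
  rewrite (bigD1 u) //= [X in _ <= X]addnC leq_add //.
    by rewrite leq_mul2l (_ : #|common u u| <= _) ?orbT //; apply/subset_leq_card/subsetP=> x;
      rewrite inE => /andP[].
  rewrite -sum_nat_const -big_split /= [X in _ <= X](bigD1 u) //=.
  apply: leq_trans (leq_addl _ _); apply: leq_sum => v /andP[vP vu].
  rewrite codenseE eq_sym vu /=.
  have [h|h] := leqP #|L| (r * #|common u v|); last by rewrite muln0 add0n ltnW.
  rewrite muln1; apply: leq_trans (leq_addr _ _); rewrite leq_mul2l.
  apply/orP; right; apply/subset_leq_card/subsetP=> x; by rewrite inE => /andP[].
have := leq_trans h1; rewrite -sum_common => /(_ _ h2).
rewrite !big_split /= -big_distrr /= -/(degsum codense P) !sum_nat_const.
move=> h3; rewrite -(leq_pmul2r L_gt0).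
have h4 : #|P| * (#|P| * #|L|) <= n * (n * #|L|) by rewrite leq_mul // leq_mul.
have h5 : #|P| * (r * #|L|) <= n * (n * #|L|) by rewrite leq_mul // leq_mul.
have h6 : n * #|P| * #|L| <= n * (n * #|L|) by rewrite -mulnA leq_mul2l leq_mul2r cardP !orbT.
have E : #|L| * n ^ 2 = n * (n * #|L|) by clear; lia.
move: h3 h4 h5 h6; rewrite E; clear; lia.
Qed.

Lemma codense_robust : exists2 W : {set V}, W \subset P & robust codense r n W.
Proof.
exact: (robust_exists codense_sym codense_irr r_gt0 P_neq0 cardP codense_degsum).
Qed.

Section Core.
Variable W : {set V}.
Hypotheses (WP : W \subset P) (robW : robust codense r n W).

Definition rich : {set V} := [set x in L | n <= 8 * r ^ 2 * #|nb e x W|].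

(** The codense degrees in [W] force the sum over [L] of the degrees into [W] to be at least
    [n * #|L| / (4 * r ^ 2)]. Vertices that are not rich contribute at most half of this, and a rich
    one at most [n]. *)
Lemma card_rich : #|L| <= 8 * r ^ 2 * #|rich|.
Proof.
have W_gt0 : 0 < #|W| by rewrite card_gt0 (robust_neq0 robW).
have h1 : #|W| * (n * #|L|) <= 4 * r ^ 2 * \sum_(x in L) #|nb e x W| ^ 2.
  rewrite -sum_common -sum_nat_const big_distrr /=; apply: leq_sum => u uW.
  apply: (@leq_trans (4 * r * #|nb codense u W| * #|L|)).
    by rewrite leq_mul2r (robust_deg robW) ?orbT.
  rewrite expnS expn1 mulnA -mulnA -[4 * r * r * _]mulnA leq_mul2l; apply/orP; right.
  rewrite card_nbE big_distrl big_distrr /=; apply: leq_sum => v _.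
  case Juv: (codense u v); last by rewrite mul0n.
  by rewrite mul1n; move: Juv; rewrite codenseE => /andP[].
have h2 : \sum_(x in L) #|nb e x W| ^ 2 <= #|W| * \sum_(x in L) #|nb e x W|.
  rewrite big_distrr /=; apply: leq_sum => x _.
  by rewrite -mulnn leq_mul2r leq_nb orbT.
have h3 : n * #|L| <= 4 * r ^ 2 * \sum_(x in L) #|nb e x W|.
  rewrite -(leq_pmul2l W_gt0) [X in _ <= X]mulnCA; apply: leq_trans h1 _.
  by rewrite leq_mul2l h2 orbT.
have h4 : 8 * r ^ 2 * \sum_(x in L) #|nb e x W| <= 8 * r ^ 2 * (#|rich| * n) + #|L| * n.
  rewrite (bigID [in rich]) /= mulnDr leq_add //.
    rewrite leq_mul2l; apply/orP; right; rewrite -sum_nat_const.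
    rewrite [X in _ <= X]big_mkcond [X in X <= _]big_mkcond /=.
    apply: leq_sum => x _.
    case: (x \in rich); last by rewrite andbF.
    case: (x \in L) => //=; apply: leq_trans (leq_nb _ _ _) _; exact: robust_card robW.
  rewrite big_distrr /= -sum_nat_const big_mkcondr /=; apply: leq_sum => x xL.
  by rewrite inE xL /=; have [|/ltnW] := leqP n (8 * r ^ 2 * #|nb e x W|).
rewrite -(leq_pmul2l n_gt0); move: h3 h4; clear.
move: (r ^ 2) #|rich| #|L| (\sum_(x in L) _) => a b c d; lia.
Qed.

(** A codense pair has more than [mu + #|U|] common neighbours, so one of them avoids both [Z] and
    [U]. *)
Lemma codense_linkable mu U : 64 * r ^ 2 * mu < n -> r * (mu + #|U|) < #|L| ->
  linkable e W (W :|: (L :\: U)) mu (72 * r + 10).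
Proof.
move=> small big.
apply: (robust_linkable e_sym codense_sym r_gt0 robW (subsetUl _ _) small).
move=> Z u v hZ uW vW; rewrite codenseE => /andP[_ huv].
have : ~~ (common u v \subset Z :|: U).
  apply/negP => /subset_leq_card h; move: big; rewrite ltnNge => /negP; apply.
  apply: leq_trans huv _; rewrite leq_mul2l; apply/orP; right.
  by apply: leq_trans h _; apply: leq_trans (leq_card_setU _ _) _; rewrite leq_add2r.
case/subsetPn => x; rewrite !inE negb_or => /and3P[xL xu xv] /andP[xZ xU].
exists ([set x; u] :|: [set x; v]); split.
- apply/subsetP => z; rewrite !inE => /orP[]/orP[]/eqP->; rewrite ?xZ ?xU ?xL ?orbT //.
    by move: uW; rewrite inE => /andP[-> ->].
  by move: vW; rewrite inE => /andP[-> ->].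
- by apply: (@connU _ _ e_sym _ _ x); rewrite ?inE ?eqxx // conn2.
- by rewrite !inE eqxx orbT.
- by rewrite !inE eqxx !orbT.
- have -> : [set x; u] :|: [set x; v] = x |: [set u; v].
    by apply/setP => z; rewrite !inE; case: (z == x); case: (z == u).
  rewrite cardsU1 cards2; by case: (_ \notin _); case: (_ != _).
Qed.

Lemma rich_model : has_model e F.
Proof.
have big1 := bign; have big2 := bigL; set c := r ^ 2 in big1 big2.
have c0 : 0 < c by rewrite expn_gt0 r_gt0.
have bigc : 64 * c * (32 * c * (#|I| * s)) < n.
  apply: leq_ltn_trans big1; rewrite leq_mul2l; apply/orP; right.
  by rewrite leq_pmull // addn_gt0 orbT.
have cr := card_rich; rewrite -/c in cr.
have rich0 : rich != set0.
  by rewrite -card_gt0; move: L_gt0 cr; case: #|rich| => //; rewrite muln0 => /leq_trans h /h.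
have EW : #|I| * (2 * (16 * c) * s) = 32 * c * (#|I| * s) by clear; lia.
(* The density [8 * c] of rich vertices is doubled to [16 * c] to make room for the vertex
   budget. *)
have [||||S [T [F' [[SW S0 TR [Sd Td] STd] [sS sT att [_ cov] F'0]]]]] :=
  @bipartite_cover V e e_sym I F W rich (16 * c) s t true _ s_gt0 (robust_neq0 robW) rich0.
- by move: c0; clear; lia.
- move=> b; rewrite inE => /andP[_]; rewrite -/c EW => h.
  have h1 := robust_card robW.
  have : 16 * c * (32 * c * (#|I| * s)) <= 64 * c * (32 * c * (#|I| * s)).
    by rewrite leq_mul2r leq_mul2r ?orbT.
  by move: h h1 bigc; rewrite -!mulnA; clear; lia.
- rewrite EW; have h1 : 32 * c * (#|I| * s) <= n.
    by apply: leq_trans (ltnW bigc); rewrite leq_pmull // muln_gt0.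
  have c80 : 0 < 8 * c by rewrite muln_gt0.
  rewrite -(leq_pmul2l c80); apply: leq_trans cr; apply: leq_trans big2.
  rewrite mulnA (_ : 8 * c * 4 = 32 * c); last by clear; lia.
  by rewrite leq_mul2l leq_add2r h1 orbT.
- by [].
rewrite EW in sS.
(* The vertices of the [T i] are reserved, so the connections between vertices of [S i] run through
   [L :\: U]. *)
pose U := \bigcup_i T i.
have cU : #|U| <= #|I| * t.+1 := leq_trans (card_bigcup_le _) sT.
pose mu := (72 * r + 11) * (32 * c * (#|I| * s)).
have mun : mu <= n.
  by apply: leq_trans (ltnW big1); rewrite leq_pmull // muln_gt0.
have lnk : linkable e W (W :|: (L :\: U)) mu (72 * r + 10).
  apply: codense_linkable; first exact: big1.
  apply: leq_trans big2; rewrite -/c.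
  have le1 : mu + #|U| <= n + #|I| * t.+1 by rewrite leq_add.
  have : r <= c by rewrite /c expnS expn1 leq_pmulr.
  have : 0 < n + #|I| * t.+1 by rewrite addn_gt0 n_gt0.
  move: le1; move: (mu + _) (n + _) r r_gt0 => a b r' r'0 le1 b0 rc.
  apply: (@leq_trans (r' * b).+1); first by rewrite ltnS leq_mul2l le1 orbT.
  by apply: (@leq_trans (2 * (r' * b))); nia.
have SS : (72 * r + 10 + 1) * #|\bigcup_i S i| <= mu.
  rewrite -addnA leq_mul2l; apply/orP; right.
  exact: leq_trans (card_bigcup_le _) sS.
have [Y [SY YO Yc Yd]] := linking e_sym lnk (subsetUl _ _) SW Sd SS.
have TL i x : x \in T i -> x \in L.
  by move=> /(subsetP (TR i)); rewrite inE => /andP[].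
have YT i j x : x \in Y i -> x \in T j -> False.
  move=> /(subsetP (YO i)); rewrite !inE => /orP[xW|/andP[/negP xU _]] xT.
    move: disPL => /pred0P/(_ x) /=.
    by rewrite (TL _ _ xT) (subsetP WP _ xW).
  by apply: xU; apply/bigcupP; exists j.
exists (fun i => Y i :|: T i); split.
- move=> i; have /set0Pn[x xS] := S0 i; apply/set0Pn; exists x.
  by rewrite inE (subsetP (SY i)).
- move=> i j x; rewrite !inE => /orP[xY|xT] /orP[yY|yT].
  + exact: Yd xY yY.
  + by case: (YT _ _ _ xY yT).
  + by case: (YT _ _ _ yY xT).
  + exact: Td xT yT.
- move=> i; have /set0Pn[x xS] := S0 i; have xY := subsetP (SY i) _ xS.
  have cY y : y \in Y i -> connect (restr e (Y i :|: T i)) x y.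
    by move=> yY; apply: connect_restrS (subsetUl _ _) (connP _ _ (Yc i) _ _ xY yY).
  apply: (@conn_root _ _ e_sym _ x) => y; rewrite inE => /orP[|yT]; first exact: cY.
  have [z zS eyz] := att _ _ yT; have zY := subsetP (SY i) _ zS.
  apply: connect_trans (cY z zY) _; apply: connect1.
  by rewrite restrE !inE zY yT orbT e_sym.
move=> i j ijF; have [|x [y [xS yT exy]]] := cov _ _ ijF; first by rewrite F'0 inE.
by exists x, y; rewrite !inE (subsetP (SY i)) // yT orbT.
Qed.

End Core.

Lemma unbalanced_model : has_model e F.
Proof. by have [W WP robW] := codense_robust; apply: rich_model WP robW. Qed.

End Unbalanced.

(** * The dichotomy *)

Section GraphFacts.
Variable G : sgraph.
Implicit Types (x y z : G) (A P S T : {set G}).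

Lemma degreeE x : degree x = #|nb (@adj G) x setT|.
Proof. by apply: eq_card => y; rewrite !inE. Qed.

Lemma sum_degree_le : \sum_(x : G) degree x <= 2 * num_edges G.
Proof.
pose D := [set p : G * G | adj p.1 p.2].
have -> : \sum_(x : G) degree x = #|D|.
  rewrite -sum1_card (eq_bigl (fun p : G * G => true && adj p.1 p.2)); last first.
    by move=> p; rewrite inE.
  rewrite -(pair_big_dep predT (fun x y => adj x y) (fun _ _ => 1)) /=.
  by apply: eq_bigr => x _; rewrite sum1_card /degree cardsE.
pose f (p : G * G) : {set G} := [set p.1; p.2].
rewrite -sum1_card (partition_big f [in edges G]) /=; last first.
  move=> [x y]; rewrite !inE /= => xy; apply/existsP; exists x; apply/existsP; exists y.
  by rewrite xy eqxx.
rewrite mulnC -sum_nat_const; apply: leq_sum => A.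
rewrite inE => /existsP[x /existsP[y /andP[xy /eqP->]]].
rewrite sum1_card; apply: (@leq_trans #|[set (x, y); (y, x)]|); last first.
  by rewrite cards2; case: (_ != _).
apply: subset_leq_card; apply/subsetP => -[u v]; rewrite unfold_in /= !inE /=.
case/andP=> uv /eqP/setP E.
have nuv : u != v by apply: contraTneq uv => ->; rewrite adj_irrefl.
have := E u; have := E v; rewrite !inE !eqxx ?orbT /= => /esym/orP[]/eqP ev /esym/orP[]/eqP eu;
  by rewrite eu ev in nuv *; rewrite ?eqxx ?orbT // in nuv *.
Qed.

Lemma card_triangles_through x y : adj x y ->
  #|triangles_through [set x; y]| <= #|nb (@adj G) y (nb (@adj G) x setT)|.
Proof.
move=> xy; have nxy : x != y by apply: contraTneq xy => ->; rewrite adj_irrefl.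
apply: leq_trans (leq_imset_card (fun z => z |: [set x; y]) _).
apply: subset_leq_card; apply/subsetP => T; rewrite !inE.
case/andP=> /andP[/eqP cT /forall_inP tri] /subsetP sub.
have xT : x \in T by apply: sub; rewrite !inE eqxx.
have yT : y \in T by apply: sub; rewrite !inE eqxx orbT.
have : #|T :\: [set x; y]| == 1.
  by rewrite cardsD cT (setIidPr _) ?cards2 ?nxy //; apply/subsetP.
case/cards1P=> z Ez; have : z \in T :\: [set x; y] by rewrite Ez inE.
rewrite !inE negb_or => /andP[/andP[zx zy] zT].
apply/imsetP; exists z.
  have /forall_inP/(_ z zT) := tri x xT; have /forall_inP/(_ z zT) := tri y yT.
  by rewrite [x == z]eq_sym [y == z]eq_sym zx zy /= !inE => -> ->.
rewrite -Ez; apply/setP => w; rewrite in_setU in_setD; case wxy: (w \in [set x; y]) => /=.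
  by rewrite sub.
by rewrite orbF.
Qed.

Lemma connectivity_conn k S : k <= connectivity G -> #|S| < k -> conn (@adj G) (~: S).
Proof.
move=> kG Sk; have k0 : 0 < k by apply: leq_ltn_trans Sk.
have [/existsP[i /andP[ki /andP[_ /forallP ci]]]|] :=
    boolP [exists i : 'I_#|G|, (k <= i) && k_connected G i].
  by have /implyP := ci S; apply; apply: leq_trans ki.
rewrite negb_exists => /forallP h; move: kG; rewrite leqNgt => /negP[].
rewrite -(ltn_predK k0) ltnS; apply/bigmax_leqP => i ci.
by have := h i; rewrite ci andbT -ltnNge -{1}(ltn_predK k0).
Qed.

Lemma connectivity_nb x : 0 < connectivity G -> exists y, adj x y.
Proof.
move=> kG; have V1 : 1 < #|G|.
  rewrite ltnNge; apply/negP => le1; move: kG; rewrite lt0n => /negP[].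
  by rewrite -leqn0; apply/bigmax_leqP => i _; rewrite -ltnS; apply: leq_trans le1.
have /set0Pn[y] : [set~ x] != set0 by rewrite -card_gt0 cardsC1 -ltnS prednK // ltnW.
rewrite !inE => yx; have := connectivity_conn kG (_ : #|set0| < 1).
rewrite cards0 => /(_ isT)/connP/(_ x y); rewrite !inE => /(_ isT isT)/connectP[[|z p]].
  by move=> _ E; rewrite E eqxx in yx.
by case/andP=> + _ _; rewrite restrE => /and3P[_ _ xz]; exists z.
Qed.

(** Markov's inequality: the average degree is at most [2 * c]. *)
Lemma low_degree_half c : num_edges G <= c * #|G| ->
  #|G| <= 2 * #|[set x : G | degree x <= 4 * c]|.
Proof.
move=> hE; set Lo := [set x | _].
have h1 : (4 * c).+1 * #|~: Lo| <= 2 * (c * #|G|).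
  apply: leq_trans (leq_mul (leqnn 2) hE); apply: leq_trans sum_degree_le.
  rewrite mulnC -sum_nat_const [X in _ <= X](bigID [in Lo]) /=.
  apply: leq_trans (leq_addl _ _); rewrite big_mkcond [X in _ <= X]big_mkcond /=.
  by apply: leq_sum => x _; rewrite inE; case: ifP => //; rewrite inE -ltnNge.
have := cardsC Lo; move: h1; move: #|Lo| #|~: Lo| #|G| => a b g; clear; nia.
Qed.

End GraphFacts.

Lemma has_model_minor (G H : sgraph) :
  has_model (@adj G) [set p : H * H | adj p.1 p.2] -> is_minor H G.
Proof.
case=> B [B0 Bd Bc Be]; exists B; split=> //.
- move=> v w vw; apply/pred0P => x /=; apply/negP => /andP[xv xw].
  by rewrite (Bd _ _ _ xv xw) eqxx in vw.
- by move=> v w vw; apply: Be; rewrite inE.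
Qed.

(** * Robust sets in neighbourhoods *)

Section Split.
Variables (G : sgraph) (q : nat).
Hypothesis q_gt0 : 0 < q.
Hypothesis codeg : forall x y : G, adj x y -> q <= #|nb (@adj G) y (nb (@adj G) x setT)|.
Hypothesis has_nb : forall x : G, exists y, adj x y.
Let n := 4 * q.+1.

(** Triangles give the neighbourhood of [x] minimum degree at least [q]; removing [P] costs at most
    [q/2], and [n <= 8 * q] explains the parameter 16. *)
Lemma robust_in_neighbourhood (x : G) (P : {set G}) :
  degree x <= n -> 2 * #|nb (@adj G) x P| <= q ->
  exists2 W : {set G}, W \subset nb (@adj G) x setT :\: P & robust (@adj G) 16 n W.
Proof.
move=> dx hP; set Nx := nb _ x setT.
have cI : #|Nx :&: P| = #|nb (@adj G) x P|.
  by apply: eq_card => z; rewrite !inE andbC.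
have deg y : y \in Nx :\: P -> n <= 16 * #|nb (@adj G) y (Nx :\: P)|.
  rewrite !inE /= => /andP[yP xy].
  have : #|nb (@adj G) y Nx| <= #|nb (@adj G) y (Nx :\: P)| + #|Nx :&: P|.
    apply: leq_trans (leq_card_setU _ _); apply: subset_leq_card.
    apply/subsetP => z; rewrite !inE /= => /andP[-> ->] /=.
    by rewrite !andbT; case: (z \in P).
  rewrite cI; have := codeg xy; rewrite -/Nx /n; move: hP q_gt0; clear; lia.
have Q0 : Nx :\: P != set0.
  have [y xy] := has_nb x; have c1 := codeg xy.
  have : q <= #|Nx| by apply: leq_trans c1 (leq_nb _ _ _).
  rewrite -(cardsID P Nx) cI -card_gt0; move: hP q_gt0; clear; lia.
apply: (@robust_exists _ _ (@adj_sym G) (@adj_irrefl G) 16 n _ isT Q0).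
  by apply: leq_trans dx; rewrite degreeE; apply/subset_leq_card/subsetDl.
by rewrite mulnC -sum_nat_const big_distrr /=; apply: leq_sum.
Qed.

(** While some vertex of low degree has at most [q/2] neighbours in [P], a robust set is taken from
    the rest of its neighbourhood, and the whole neighbourhood is added to [P]. *)
Lemma disjoint_robust_or_dominating k :
  (exists P : {set G}, #|P| <= k * n /\
     forall x : G, degree x <= n -> q < 2 * #|nb (@adj G) x P|) \/
  (exists (W : nat -> {set G}) (P : {set G}), [/\ #|P| <= k * n,
     forall j, j < k -> W j \subset P, forall j, j < k -> robust (@adj G) 16 n (W j)
   & forall i j x, i < k -> j < k -> x \in W i -> x \in W j -> i = j]).
Proof.
elim: k => [|k [[P [cP hP]]|[W [P [cP WP robW disW]]]]].
- by right; exists (fun _ => set0), set0; rewrite cards0; split.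
- by left; exists P; split=> //; apply: leq_trans cP _; rewrite leq_mul2r leqnSn orbT.
have [/existsP[x /andP[dx hx]]|] :=
    boolP [exists x : G, (degree x <= n) && (2 * #|nb (@adj G) x P| <= q)]; last first.
  rewrite negb_exists => /forallP h; left; exists P; split.
    by apply: leq_trans cP _; rewrite leq_mul2r leqnSn orbT.
  by move=> x dx; have := h x; rewrite dx /= -ltnNge.
have [U UQ robU] := robust_in_neighbourhood dx hx.
right; exists (fun j => if j == k then U else W j), (P :|: nb (@adj G) x setT).
have UP z : z \in U -> z \notin P by move/(subsetP UQ); rewrite inE => /andP[].
have lt j : j < k.+1 -> j != k -> j < k by rewrite ltnS leq_eqVlt => /orP[/eqP->|//]; rewrite eqxx.
split.
- apply: leq_trans (leq_card_setU _ _) _; rewrite mulSn addnC leq_add //.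
  by rewrite -degreeE.
- move=> j jk; case: eqVneq => [_|nj].
    by apply: subset_trans UQ _; apply: subset_trans (subsetDl _ _) (subsetUr _ _).
  by apply: subset_trans (WP j (lt _ jk nj)) (subsetUl _ _).
- by move=> j jk; case: eqVneq => [_ //|nj]; apply: robW; apply: lt.
move=> i j z ik jk; case: eqVneq => [->|ni]; case: eqVneq => [->|nj] //.
- by move=> zU /(subsetP (WP _ (lt _ jk nj))); rewrite (negbTE (UP _ zU)).
- by move=> /(subsetP (WP _ (lt _ ik ni))) zP zU; move: (UP _ zU); rewrite zP.
- by apply: disW; apply: lt.
Qed.

End Split.

Lemma minor_of_parameters (G H : sgraph) (q M s s' t : nat) (r := 4 * (8 * M.+1) ^ 2) :
  0 < #|H| -> 0 < q -> num_edges G <= q.+1 * #|G| ->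
  (forall A, A \in edges G -> q <= #|triangles_through A|) ->
  #|H| * M.+1 <= connectivity G -> M < s -> 0 < s' ->
  64 * 16 ^ 2 * ((72 * 16 + 11) * (#|H| * s * (16 * 16 + 4))) < 4 * q.+1 ->
  64 * r ^ 2 * ((72 * r + 11) * (32 * r ^ 2 * (#|H| * s'))) < 4 * q.+1 ->
  \sum_(v : H) degree v <= 2 ^ (s * s * M.+1) * #|H| ->
  \sum_(v : H) degree v <= 2 ^ (s' * t) * #|H| ->
  2 * (32 * r ^ 2 * (M.+1 * (4 * q.+1) + #|H| * t.+1) + M.+1 * (4 * q.+1)) <= #|G| ->
  is_minor H G.
Proof.
move=> H0 q0 hE hT hK Ms s'0 bigA bigB FA FB bigG; apply: has_model_minor.
set F := [set p : H * H | adj p.1 p.2].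
have cF : #|F| = \sum_(v : H) degree v.
  rewrite -card_fibers; apply: eq_bigr => v _; apply: eq_card => w.
  by rewrite !inE /= adj_sym.
rewrite -cF in FA FB.
have codeg (x y : G) : adj x y -> q <= #|nb (@adj G) y (nb (@adj G) x setT)|.
  move=> xy; apply: leq_trans (card_triangles_through xy); apply: hT.
  by rewrite inE; apply/existsP; exists x; apply/existsP; exists y; rewrite xy eqxx.
have hnb (x : G) : exists y, adj x y.
  by apply: connectivity_nb; apply: leq_trans hK; rewrite muln_gt0 H0.
have [[P [cP hP]]|[W [P [_ _ robW disW]]]] := disjoint_robust_or_dominating q0 codeg hnb M.+1.
  pose L := [set x : G | degree x <= 4 * q.+1] :\: P.
  have cL : 32 * r ^ 2 * (M.+1 * (4 * q.+1) + #|H| * t.+1) <= #|L|.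
    have h1 := low_degree_half hE.
    have h2 : #|[set x : G | degree x <= 4 * q.+1]| <= #|L| + #|P|.
      by rewrite -(cardsID P) addnC leq_add2l; apply/subset_leq_card/subsetIr.
    set a := 32 * r ^ 2 * _ in bigG *; set b := M.+1 * _ in cP bigG.
    move: bigG h1 h2 cP; clear; move: a b => a b; lia.
  (* More than [q/2] neighbours in [P], measured against the scale [M.+1 * (4 * q.+1)], give the
     density parameter [8 * M.+1]. *)
  apply: (@unbalanced_model G (@adj G) (@adj_sym G) H F P L
            (M.+1 * (4 * q.+1)) r (8 * M.+1) s' t) => //.
  - by rewrite -setI_eq0; apply/eqP/setP => x; rewrite !inE; case: (x \in P).
  - move=> x; rewrite inE => /andP[_]; rewrite inE => /hP h.
    by rewrite [8 * _]mulnC -mulnA leq_mul2l; apply/orP; right; move: h; clear; lia.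
  - by apply: leq_trans bigB _; rewrite leq_pmull.
pose W' (j : 'I_M.+1) := W j.
apply: (@pieces_model G (@adj G) (@adj_sym G) H F M 16 (4 * q.+1) s W') => //.
- by move=> j; apply: robW.
- by move=> i j x xi xj; apply/val_inj/(disW i j x).
- by move=> S; apply: connectivity_conn.
Qed.

(** The quantifiers record the order of choices: [cA] is absolute and determines [M], then [cB]
    depends on [M] and determines [Q], and [K] depends on both [M] and [Q]. *)
Lemma minor_thresholds :
  exists2 cA, 0 < cA & forall M, exists2 cB, 0 < cB & forall Q, exists K,
  forall (G H : sgraph) (q s s' : nat),
  0 < #|H| -> 0 < q -> num_edges G <= q.+1 * #|G| ->
  (forall A, A \in edges G -> q <= #|triangles_through A|) ->
  #|H| * M.+1 <= connectivity G -> M < s -> 0 < s' ->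
  cA * (#|H| * s) < 4 * q.+1 -> cB * (#|H| * s') < 4 * q.+1 ->
  \sum_(v : H) degree v <= 2 ^ (s * s * M.+1) * #|H| ->
  \sum_(v : H) degree v <= 2 ^ (s' * s' * Q.+1) * #|H| ->
  K * q <= #|G| -> is_minor H G.
Proof.
have reg a b c h s : a * (b * (h * s * c)) = a * (b * c) * (h * s).
  by rewrite [h * s * c]mulnC !mulnA.
exists (64 * 16 ^ 2 * ((72 * 16 + 11) * (16 * 16 + 4))).
  by rewrite !muln_gt0 !addn_gt0 !orbT.
move=> M; have [r rE r0] : exists2 r, r = 4 * (8 * M.+1) ^ 2 & 0 < r.
  by exists (4 * (8 * M.+1) ^ 2); rewrite ?muln_gt0.
exists (64 * r ^ 2 * ((72 * r + 11) * (32 * r ^ 2))).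
  by rewrite !muln_gt0 r0 addn_gt0 orbT.
move=> Q; exists (16 * (32 * r ^ 2 * (M + Q + 3) + M.+1)).
move=> G H q s s' H0 q0 hE hT hK Ms s'0 hA hB FA FB hG.
apply: (@minor_of_parameters G H q M s s' (s' * Q.+1) H0 q0 hE hT hK Ms s'0).
- by rewrite reg; exact: hA.
- have reg' a b c h : a * (b * (c * h)) = a * (b * c) * h by rewrite !mulnA.
  by rewrite -rE reg'; exact: hB.
- exact: FA.
- by rewrite mulnA; exact: FB.
rewrite -rE; apply: leq_trans hG.
have h2 : #|H| * s' <= 4 * q.+1.
  by apply: leq_trans (ltnW hB); rewrite leq_pmull // !muln_gt0 r0 addn_gt0 orbT.
have h3 : #|H| <= 4 * q.+1 by apply: leq_trans h2; rewrite leq_pmulr.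
have h4 : #|H| * (s' * Q.+1).+1 <= Q.+2 * (4 * q.+1).
  rewrite [Q.+2 * _]mulSn mulnS; apply: leq_add => //.
  by rewrite mulnA mulnC leq_mul2l h2 orbT.
have h5 : 4 * q.+1 <= 8 * q by move: q0; clear; lia.
have h6 : M.+1 * (4 * q.+1) + #|H| * (s' * Q.+1).+1 <= (M + Q + 3) * (8 * q).
  apply: leq_trans (leq_add (leqnn _) h4) _; rewrite -mulnDl.
  by apply: leq_mul h5; clear; lia.
have h7 : M.+1 * (4 * q.+1) <= M.+1 * (8 * q) by rewrite leq_mul2l h5 orbT.
apply: (@leq_trans (2 * (32 * r ^ 2 * ((M + Q + 3) * (8 * q)) + M.+1 * (8 * q)))).
  by rewrite leq_mul2l /= leq_add // leq_mul2l h6 orbT.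
by move: (r ^ 2) => c; clear; lia.
Qed.

(** * Choice of parameters *)

Import Order.TTheory GRing.Theory Num.Theory.
Local Open Scope ring_scope.

(** Rounding down loses at most a factor 2, so [s ^ 2] is at least [eps ^ 2 * ln d / (4 * c ^ 2)]; a
    constant multiple of it in the exponent of 2 reaches [d]. *)
Lemma exponent_choice (R : realType) (eps : R) (c : nat) :
  0 < eps -> (0 < c)%N ->
  exists Q : nat, forall d : R, 1 <= d -> 2 * c%:R <= eps * Num.sqrt (ln d) ->
    forall s : nat, s = Num.truncn (eps * Num.sqrt (ln d) / c%:R) ->
    [/\ (0 < s)%N, (c * s)%:R <= eps * Num.sqrt (ln d)
      & d <= (2 ^ (s * s * Q.+1))%:R].
Proof.
move=> e0 c0; have cR : 0 < c%:R :> R by rewrite ltr0n.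
have ln2 : 0 < ln (2 : R) by rewrite ln_gt0 // ltr1n.
set X : R := 4 * c%:R ^+ 2 / (eps ^+ 2 * ln 2).
exists (Num.truncn X) => d d1 big s ->; set l := Num.sqrt (ln d) in big *.
have lnd : 0 <= ln d := ln_ge0 d1.
have l2 : l ^+ 2 = ln d by rewrite sqr_sqrtr.
have y2 : 2 <= eps * l / c%:R by rewrite ler_pdivlMr.
have y0 : 0 <= eps * l / c%:R by lra.
have /andP[sy ys] := truncn_itv y0.
move: (Num.truncn (eps * l / c%:R)) sy ys => {}s sy ys.
have s1 : eps * l / c%:R <= 2 * s%:R by move: ys; rewrite -natr1; lra.
split.
- by rewrite -(ltr_nat R); move: s1 y2; lra.
- by rewrite natrM mulrC -ler_pdivlMr.
have QX : X < (Num.truncn X).+1%:R := truncnS_gt X.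
have d0 : 0 < d by apply: lt_le_trans d1.
rewrite -ler_ln ?posrE ?ltr0n ?expn_gt0 // natrX lnXn ?ltr0n // -l2.
rewrite -[ln 2 *+ _]mulr_natl natrM.
have s2 : eps * l <= 2 * s%:R * c%:R by rewrite -ler_pdivrMr.
have l0 : 0 <= l by apply: sqrtr_ge0.
have XE : X * (eps ^+ 2 * ln 2) = 4 * c%:R ^+ 2.
  by rewrite /X mulfVK // mulf_neq0 // ?expf_neq0 ?gt_eqF.
have c2 : 0 < c%:R ^+ 2 :> R by rewrite exprn_gt0.
have h1 : (eps * l) ^+ 2 <= (2 * s%:R * c%:R) ^+ 2.
  by rewrite ler_sqr ?nnegrE // ?mulr_ge0 // ltW.
have h2 : eps ^+ 2 * l ^+ 2 <= s%:R ^+ 2 * (X * (eps ^+ 2 * ln 2)).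
  by rewrite XE; move: h1; rewrite !exprMn; lra.
have e2 : 0 < eps ^+ 2 by rewrite exprn_gt0.
have h3 : l ^+ 2 <= s%:R ^+ 2 * X * ln 2.
  rewrite -(ler_pM2l e2); apply: le_trans h2 _.
  by rewrite le_eqVlt; apply/orP; left; apply/eqP; ring.
apply: le_trans h3 _; rewrite ler_pM2r // natrM -expr2.
by apply: ler_wpM2l; [apply: sqr_ge0|apply: ltW].
Qed.

Theorem theorem1p7 (R : realType) (eps : R) (eps_gt0 : 0 < eps) :
  exists D2 : R, forall (H : sgraph) (d m : R) (G : sgraph),
    d = avg_degree R H ->
    D2 < d ->
    eps * #|H|%:R * Num.sqrt (ln d) <= m ->
    D2 * m <= #|G|%:R ->
    D2 * #|H|%:R <= (connectivity G)%:R ->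
    (num_edges G)%:R <= m * #|G|%:R ->
    (forall A : {set G}, A \in edges G -> m - 1 < #|triangles_through A|%:R) ->
    is_minor H G.
Proof.
have [cA cA0 hA] := minor_thresholds.
have [M hM] := exponent_choice eps_gt0 cA0.
have [cB cB0 hB] := hA M.
have [Q hQ] := exponent_choice eps_gt0 cB0.
have [K hQK] := hB Q.
(* Each summand is a lower bound wanted for [eps * l]: for [1 <= m], for the two uses of
   [exponent_choice], and for [M < s]. *)
pose lam : R := (1 + 2 * cA%:R + cA%:R * M.+2%:R + 2 * cB%:R) / eps.
exists (1 + expR (lam ^+ 2) + M.+1%:R + K%:R) => H d m G dE.
set D2 := _ + K%:R => dD hm hG hK hE hT.
have D1 : 1 <= D2.
  have := expR_ge0 (lam ^+ 2); have : 0 <= M.+1%:R :> R by [].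
  have : 0 <= K%:R :> R by []. rewrite /D2; lra.
have DM : M.+1%:R <= D2.
  have := expR_ge0 (lam ^+ 2); have : 0 <= K%:R :> R by []. rewrite /D2; lra.
have DK : K%:R <= D2.
  have := expR_ge0 (lam ^+ 2); have : 0 <= M.+1%:R :> R by []. rewrite /D2; lra.
have De : expR (lam ^+ 2) <= D2.
  have : 0 <= M.+1%:R :> R by []. have : 0 <= K%:R :> R by []. rewrite /D2; lra.
have d1 : 1 <= d by apply: ltW; apply: le_lt_trans dD.
have d0 : 0 < d by apply: lt_le_trans d1.
have H0 : (0 < #|H|)%N.
  rewrite lt0n; apply/eqP => H0; move: d0; rewrite dE /avg_degree H0 invr0 mulr0 ltxx //.
have HR : 0 < #|H|%:R :> R by rewrite ltr0n.
have sumd : (\sum_(v : H) degree v)%N%:R = d * #|H|%:R.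
  by rewrite dE /avg_degree divfK // gt_eqF.
have cA_ge0 : 0 <= cA%:R :> R by []. have cB_ge0 : 0 <= cB%:R :> R by [].
have cAM : 0 <= cA%:R * M.+2%:R :> R by rewrite mulr_ge0.
have lam0 : 0 <= lam by rewrite /lam divr_ge0 ?ltW //; lra.
set l := Num.sqrt (ln d) in hm.
have lam_le : lam <= l.
  rewrite -(ger0_norm lam0) -sqrtr_sqr.
  apply: ler_wsqrtr; rewrite -[lam ^+ 2]expRK ler_ln ?posrE ?expR_gt0 //.
  by apply: ltW; apply: le_lt_trans De dD.
have el : 1 + 2 * cA%:R + cA%:R * M.+2%:R + 2 * cB%:R <= eps * l.
  by rewrite [leRHS]mulrC -ler_pdivrMr.
have bigA : 2 * cA%:R <= eps * l by lra.
have bigB : 2 * cB%:R <= eps * l by lra.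
have bigM : cA%:R * M.+2%:R <= eps * l by lra.
have el1 : 1 <= eps * l by lra.
pose s := Num.truncn (eps * l / cA%:R); pose s' := Num.truncn (eps * l / cB%:R).
have Ms : (M < s)%N.
  rewrite /s truncn_gt_nat ler_pdivlMr ?ltr0n // mulrC.
  by apply: le_trans bigM; rewrite ler_wpM2l // ler_nat.
have m1 : 1 <= m.
  apply: le_trans hm; rewrite mulrAC.
  have h1 : 1 <= #|H|%:R :> R by rewrite ler1n.
  by apply: le_trans el1 _; rewrite ler_peMr //; lra.
(* From [q <= m < q + 1], more than [m - 1] triangles means at least [q], and at most [m * #|G|]
   edges means at most [q.+1 * #|G|]. *)
pose q := Num.truncn m.
have m0 : 0 <= m by apply: le_trans m1.
have /andP[qm mq] := truncn_itv m0; rewrite -/q in qm mq.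
have q0 : (0 < q)%N by rewrite truncn_gt0.
(* The lower bound on [m] enters here: [c * s1 * #|H| <= eps * #|H| * l <= m]. *)
have hc c (s1 : nat) : (c * s1)%:R <= eps * l -> (c * (#|H| * s1) < 4 * q.+1)%N.
  move=> h; rewrite -(ltr_nat R); apply: (@le_lt_trans _ _ m); last first.
    apply: lt_le_trans mq _; rewrite ler_nat; clear; lia.
  apply: le_trans hm; rewrite mulnCA natrM mulrAC [leRHS]mulrC.
  by rewrite ler_pM2l.
have Fle (k : nat) : d <= (2 ^ k)%:R -> (\sum_(v : H) degree v <= 2 ^ k * #|H|)%N.
  by move=> h; rewrite -(ler_nat R) sumd natrM ler_pM2r.
have [s0 cs ds] := hM d d1 bigA s erefl.
have [s'0 cs' ds'] := hQ d d1 bigB s' erefl.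
apply: (hQK G H q s s') => //.
- rewrite -(ler_nat R) natrM; apply: le_trans hE _.
  by apply: ler_wpM2r => //; apply: ltW.
- move=> A /hT; rewrite ltrBlDr => h; rewrite -ltnS -(ltr_nat R).
  by apply: le_lt_trans qm _; rewrite -natr1.
- rewrite -(ler_nat R) natrM; apply: le_trans hK; rewrite mulrC.
  by apply: ler_wpM2r.
- exact: hc.
- exact: hc.
- exact: Fle.
- exact: Fle.
- rewrite -(ler_nat R) natrM; apply: le_trans hG.
  by apply: ler_pM.
Qed.
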